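(* Let $k$ be even and let $G_0$ be a connected non-odd-bipartite $k$-uniform hypergraph, and let $m\ge 1$. Let $\mathcal{T}_m(G_0)$ be the class of $k$-uniform hypergraphs obtained from $G_0$ by attaching hypertrees at vertices of $G_0$ (each time identifying one vertex of a hypertree with some vertex of $G_0$) such that the total number of edges equals $\varepsilon(G_0)+m$. If $G\in\mathcal{T}_m(G_0)$ satisfies $\lambda_{\min}(G)=\min\{\lambda_{\min}(G'):G'\in\mathcal{T}_m(G_0)\}$, then $G=G_0(u)\diamond P_m^k(u)$ for some vertex $u$ of $G_0$, i.e. $G$ is obtained by identifying a vertex $u$ of $G_0$ with a pendent vertex of the hyperpath $P_m^k$.
   Context: A $k$-uniform hypergraph $G=(V(G),E(G))$ has every edge a $k$-subset of $V(G)$; $\nu(G)=|V(G)|$, $\varepsilon(G)=|E(G)|$, $d_G(v)$ is the number of edges containing $v$, $E_G(v)$ the set of edges containing $v$. A walk is a sequence $v_0e_1v_1\dots e_lv_l$ with $v_{i-1},v_i\in e_i$; a path is a walk with all vertices and edges distinct; $G$ is connected if any two vertices are joined by a walk. A hypertree is a connected acyclic hypergraph (equivalently, for connected $k$-uniform $G$: $\varepsilon(G)=(\nu(G)-1)/(k-1)$). For $x\in\mathbb{R}^{V(G)}$ and $U\subseteq V(G)$ write $x^U=\prod_{v\in U}x_v$ and $x_U^k=\sum_{v\in U}x_v^k$. The signless Laplacian tensor is $\mathcal{Q}(G)=\mathcal{D}(G)+\mathcal{A}(G)$, where $\mathcal{D}(G)$ is the diagonal order-$k$ tensor with diagonal entries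 $d(v)$ and $\mathcal{A}(G)$ has entry $1/(k-1)!$ at $(i_1,\dots,i_k)$ if $\{v_{i_1},\dots,v_{i_k}\}\in E(G)$ and $0$ otherwise. A real $\lambda$ is an H-eigenvalue if some nonzero real $x$ satisfies $(\lambda-d(v))x_v^{k-1}=\sum_{e\in E(v)}x^{e\setminus\{v\}}$ for all $v$. The least eigenvalue $\lambda_{\min}(G)$ is the least H-eigenvalue of $\mathcal{Q}(G)$; for even $k$ it equals $\min\{\sum_{e\in E(G)}(x_e^k+kx^e): x\in\mathbb{R}^{V(G)},\ \sum_v|x_v|^k=1\}$. A $k$-uniform hypergraph ($k$ even) is odd-bipartite if there is a bipartition $\{V_1,V_2\}$ of its vertex set such that every edge meets $V_1$ in an odd number of vertices; otherwise non-odd-bipartite. The coalescence $G_1(v_1)\diamond G_2(v_2)$ of vertex-disjoint hypergraphs is obtained by identifying $v_1\in V(G_1)$ with $v_2\in V(G_2)$ into a new vertex $u$, also written $G_1(u)\diamond G_2(u)$. The hyperpath $P_m^k$ is obtained from the path graph with $m$ edges by enlarging each edge with $k-2$ new vertices; a pendent edge is an edge containing $k-1$ vertices of degree one, and these are pendent vertices. *)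

(* Defs.v *)
From mathcomp Require Import all_boot all_order all_algebra.
From mathcomp Require Import boolp classical_sets reals.

Set Implicit Arguments.
Unset Strict Implicit.
Unset Printing Implicit Defensive.

Import Order.TTheory GRing.Theory Num.Theory.
Local Open Scope ring_scope.

Record hypergraph := Hypergraph {
  vertex :> finType;
  edges : {set {set vertex}}
}.

Definition k_uniform (k : nat) (G : hypergraph) : Prop :=
  forall e : {set G}, e \in edges G -> #|e| = k.

Definition degree (G : hypergraph) (v : G) : nat :=
  #|[set e in edges G | v \in e]|.

(* The walk v0 e1 v1 ... el vl is represented by its origin v0 and the list
   of its steps (e1, v1), ..., (el, vl). *)
Fixpoint walk (G : hypergraph) (v : G) (s : seq ({set G} * G)) : bool :=
  if s is (e, w) :: s' then
    [&& e \in edges G, v \in e, w \in e & walk w s']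
  else true.

Definition walk_end (G : hypergraph) (v : G) (s : seq ({set G} * G)) : G :=
  last v (unzip2 s).

Definition hconnected (G : hypergraph) : Prop :=
  forall u v : G, exists s, walk u s /\ walk_end u s = v.

(* Two distinct edges sharing two vertices form a cycle of length 2; the
   closed walk v e v of length 1 is not a cycle. *)
Definition berge_cycle (G : hypergraph) (v : G) (s : seq ({set G} * G)) : Prop :=
  [/\ (2 <= size s)%N, walk v s, walk_end v s = v,
      uniq (unzip1 s) & uniq (unzip2 s)].

Definition acyclic (G : hypergraph) : Prop :=
  forall (v : G) (s : seq ({set G} * G)), ~ berge_cycle v s.

Definition hypertree (G : hypergraph) : Prop := hconnected G /\ acyclic G.

(* V1 and its complement are the two parts; either may be empty when there
   are no edges, so an edgeless hypergraph is odd-bipartite. *)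
Definition odd_bipartite (G : hypergraph) : Prop :=
  exists V1 : {set G}, forall e, e \in edges G -> odd #|e :&: V1|.

Definition isomorphic (G H : hypergraph) : Prop :=
  exists f : G -> H,
    bijective f /\ edges H = [set f @: e | e : {set G} in edges G].

Section Coalescence.
Variables (G1 G2 : hypergraph) (v1 : G1) (v2 : G2).

Definition coal_vertex : finType := (G1 + {v : G2 | v != v2})%type.

Definition coal_inl (v : G1) : coal_vertex := inl v.

Definition coal_inr (v : G2) : coal_vertex :=
  if insub v is Some w then inr w else inl v1.

Definition coalescence : hypergraph :=
  @Hypergraph coal_vertex
    ([set coal_inl @: e | e : {set G1} in edges G1]
     :|: [set coal_inr @: e | e : {set G2} in edges G2]).

End Coalescence.

(* [attached k f] : G arises from G0 by successively attaching k-uniform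
   hypertrees at vertices of G0, whose copies in G are given by f : G0 -> G. *)
Inductive attached (k : nat) (G0 : hypergraph) :
    forall G : hypergraph, (G0 -> G) -> Prop :=
| attached_refl : attached k (fun v : G0 => v)
| attached_step (G : hypergraph) (f : G0 -> G) (T : hypergraph)
    (u : G0) (r : T) :
    attached k f -> k_uniform k T -> hypertree T ->
    attached k (fun v : G0 => @coal_inl G T r (f v) : coalescence (f u) r).

Definition attach_class (k m : nat) (G0 G : hypergraph) : Prop :=
  (exists (G' : hypergraph) (f : G0 -> G'), attached k f /\ isomorphic G G')
  /\ #|edges G| = (#|edges G0| + m)%N.

(* The vertices inl 0, ..., inl m are those of the path graph; inr (i, j),
   j < k - 2, are the new vertices enlarging its i-th edge. *)
Definition hyperpath_vertex (k m : nat) : finType :=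
  ('I_m.+1 + 'I_m * 'I_(k - 2))%type.

Definition hyperpath_edge (k m : nat) (i : 'I_m) :
    {set hyperpath_vertex k m} :=
  [set w : hyperpath_vertex k m |
    match w with
    | inl j => (j == i :> nat) || (j == i.+1 :> nat)
    | inr p => p.1 == i
    end].

Definition hyperpath (k m : nat) : hypergraph :=
  Hypergraph [set hyperpath_edge k i | i : 'I_m].

(* "At least k - 1" so that the edge of a one-edge hyperpath, all of whose k
   vertices have degree one, is pendent. *)
Definition pendent_edge (k : nat) (G : hypergraph) (e : {set G}) : bool :=
  (e \in edges G) && (k - 1 <= #|[set v in e | degree v == 1%N]|)%N.

Definition pendent_vertex (k : nat) (G : hypergraph) (v : G) : Prop :=
  degree v = 1%N /\ exists e : {set G}, pendent_edge k e /\ v \in e.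

(* Real tensors of order n + 1 with all indices ranging over V. *)
Definition tensor (R : realType) (n : nat) (V : finType) : Type :=
  n.+1.-tuple V -> R.

(* The vector T x^n, with n = order - 1. *)
Definition tensor_apply (R : realType) (n : nat) (V : finType)
    (T : tensor R n V) (x : {ffun V -> R}) (v : V) : R :=
  \sum_(t : n.-tuple V) T (cons_tuple v t) * \prod_(i < n) x (tnth t i).

Definition H_eigenvalue (R : realType) (n : nat) (V : finType)
    (T : tensor R n V) (lambda : R) : Prop :=
  exists x : {ffun V -> R},
    x != 0 /\ forall v, tensor_apply T x v = lambda * x v ^+ n.

Section SignlessLaplacian.
Variables (R : realType) (k : nat) (G : hypergraph).

(* The tensors below have order k.-1.+1, i.e. k, for positive k. *)
Definition degree_tensor : tensor R k.-1 G :=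
  fun t => if constant t then (degree (thead t))%:R else 0.

Definition adjacency_tensor : tensor R k.-1 G :=
  fun t => if [set v in t] \in edges G then (k.-1`!%:R)^-1 else 0.

Definition signless_laplacian : tensor R k.-1 G :=
  fun t => degree_tensor t + adjacency_tensor t.

End SignlessLaplacian.

Definition is_least (R : realType) (A : set R) (l : R) : Prop :=
  A l /\ lbound A l.

(* l is the least H-eigenvalue of the signless Laplacian tensor of G. *)
Definition is_lambda_min (R : realType) (k : nat) (G : hypergraph) (l : R) :
    Prop :=
  is_least (fun mu => H_eigenvalue (@signless_laplacian R k G) mu) l.

(* Main.v *)
(* Write X = |x| for an eigenvector x of the least eigenvalue l of G, and list
   the m edges of the attached hypertrees so that each edge e_i meets the
   vertices reached before it in a single vertex p_i.  Truncating entries from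
   below, X |-> max(X, s), does not increase sum_(v in e) X_v^k - k prod_(v in e)
   X_v.  Hence G can be compared with the hyperpath attached at a vertex u of G0
   where X is maximal: its i-th edge receives the values of e_i truncated at
   level s_i, where s_1 = X_u and s_(i+1) is the largest value on the i-th edge.
   The form does not increase and the norm does not decrease, so minimality of l
   forces equality, that is X_(p_i) = s_i and X >= s_i on the new vertices of
   e_i.  The eigenvalue equations then make the levels strictly increasing, so
   p_(i+1) is one of the new vertices of e_i, and the attached part of G is
   itself a hyperpath.  If X vanished on G0, the same comparison with a small
   constant on G0 would beat l. *)
Require Import Defs.
From mathcomp Require Import boolp classical_sets functions reals topology.
From mathcomp Require Import normedtype derive realfun exp.
From mathcomp Require Import all_boot all_order all_algebra all_fingroup ring lra.

Set Implicit Arguments.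
Unset Strict Implicit.
Unset Printing Implicit Defensive.

Import Order.TTheory GRing.Theory Num.Theory.
Local Open Scope nat_scope.

(** * Growing a hypertree edge by edge *)

Section Growth.
Variable k : nat.

(* A step (p, C) attaches the edge p |: C at p; C is its set of new vertices. *)
Definition step_edge (V : finType) (q : V * {set V}) : {set V} := q.1 |: q.2.

Definition map_step (V W : finType) (h : V -> W) (q : V * {set V}) :=
  (h q.1, h @: q.2).

(** Each edge meets the set reached before it exactly in its attaching vertex, so arguments about
    acyclic attachments become inductions on [s]. *)
Fixpoint growth (V : finType) (A : {set V}) (s : seq (V * {set V}))
    (B : {set V}) : bool :=
  if s is q :: s' then
    [&& q.1 \in A, [disjoint A & q.2], #|q.2| == k.-1 & growth (A :|: q.2) s' B]
  else A == B.

Lemma growth_cat (V : finType) (A B D : {set V}) s1 s2 :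
  growth A s1 B -> growth B s2 D -> growth A (s1 ++ s2) D.
Proof.
elim: s1 A => [|q s1 IH] A /=; first by move/eqP->.
by case/and4P=> -> -> -> /= h1 h2; exact: IH h1 h2.
Qed.

Lemma growth_rcons (V : finType) (A B : {set V}) s q :
  growth A (rcons s q) B ->
  exists D, [/\ growth A s D, q.1 \in D, [disjoint D & q.2],
                #|q.2| = k.-1 & B = D :|: q.2].
Proof.
elim: s A => [|q' s IH] A /=.
  by case/and4P=> h1 h2 /eqP h3 /eqP <-; exists A.
case/and4P=> h1 h2 h3 /IH[D [g d1 d2 d3 d4]].
by exists D; rewrite h1 h2 h3.
Qed.

Lemma growth_sub (V : finType) (A B : {set V}) s : growth A s B -> A \subset B.
Proof.
elim: s A => [|q s IH] A /=; first by move/eqP->.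
by case/and4P=> _ _ _ /IH h; exact: subset_trans (subsetUl _ _) h.
Qed.

Lemma growth_edge_sub (V : finType) (A B : {set V}) s e :
  growth A s B -> e \in map (@step_edge V) s -> e \subset B.
Proof.
elim: s A => [//|q s IH] A /= /and4P[h1 h2 _ h4].
rewrite inE => /orP[/eqP->|]; last exact: IH h4.
apply: subset_trans (growth_sub h4).
by apply: setSU; rewrite sub1set.
Qed.

Lemma growth_card (V : finType) (A B : {set V}) s e :
  0 < k -> growth A s B -> e \in map (@step_edge V) s -> #|e| = k.
Proof.
move=> k0; elim: s A => [//|q s IH] A /= /and4P[h1 h2 /eqP h3 h4].
rewrite inE => /orP[/eqP->|]; last exact: IH h4.
by rewrite cardsU1 h3 (disjointFr h2 h1) add1n prednK.
Qed.

Lemma growth_map (V W : finType) (h : V -> W) (A B : {set V}) s :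
  injective h -> growth A s B ->
  growth (h @: A) (map (map_step h) s) (h @: B).
Proof.
move=> hi; elim: s A => [|q s IH] A /=; first by move/eqP->.
case/and4P=> h1 h2 h3 /IH.
rewrite imsetU => ->; rewrite imset_f // card_imset // h3 /= andbT.
rewrite disjoint_subset; apply/subsetP=> _ /imsetP[x xA ->].
rewrite inE; apply/negP=> /imsetP[y yB /hi E].
by move: (disjointFr h2 xA); rewrite E yB.
Qed.

(** Vertices of [D] that [s] never adds may be present from the start. This glues a hypertree grown
    from its root onto a whole hypergraph. *)
Lemma growth_frame (V : finType) (A B D : {set V}) s :
  [disjoint D & B :\: A] -> growth A s B -> growth (A :|: D) s (B :|: D).
Proof.
elim: s A => [|q s IH] A /= dD; first by move/eqP->.
case/and4P=> h1 h2 h3 h4; rewrite inE h1 h3 /=.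
have sB : A :|: q.2 \subset B := growth_sub h4.
apply/andP; split.
  rewrite disjoint_subset; apply/subsetP=> x; rewrite !inE => /orP[xA|xD].
    by rewrite (disjointFr h2 xA).
  move: (disjointFr dD xD); rewrite inE => /negbT; rewrite negb_and negbK.
  case/orP=> [xA|]; first by rewrite (disjointFr h2 xA).
  by apply: contra => xq; apply: (subsetP sB); rewrite inE xq orbT.
rewrite setUAC; apply: IH => //.
by apply: disjointWr dD; apply: setDS; exact: subsetUl.
Qed.

Lemma step_edge_map (V W : finType) (h : V -> W) (s : seq (V * {set V})) :
  map (@step_edge W) (map (map_step h) s) =
  map (fun e : {set V} => h @: e) (map (@step_edge V) s).
Proof.
by rewrite -!map_comp; apply: eq_map => q /=; rewrite /step_edge /= imsetU1.
Qed.

Lemma growth_big_vertex (T : Type) (idx : T) (op : Monoid.com_law idx)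
    (V : finType) (A B : {set V}) s (F : V -> T) :
  growth A s B ->
  \big[op/idx]_(v in B) F v =
    op (\big[op/idx]_(v in A) F v)
       (\big[op/idx]_(q <- s) \big[op/idx]_(v in q.2) F v).
Proof.
elim: s A => [|q s IH] A /=.
  by move/eqP->; rewrite big_nil Monoid.mulm1.
case/and4P=> _ h2 _ /IH ->.
rewrite big_cons Monoid.mulmA; congr (op _ _).
apply: eq_trans _ (@bigU _ _ op _ [in A] [in q.2] F h2).
by apply: eq_bigl => v; rewrite !inE.
Qed.

(** Since [1 < k], every step brings a new vertex, so its edge differs from all earlier ones and no
    edge is counted twice. *)
Lemma growth_big_edge (T : Type) (idx : T) (op : Monoid.com_law idx)
    (V : finType) (A B : {set V}) s (E : {set {set V}}) (F : {set V} -> T) :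
  1 < k -> growth A s B -> (forall e, e \in E -> e \subset A) ->
  \big[op/idx]_(e in E :|: [set e in map (@step_edge V) s]) F e =
    op (\big[op/idx]_(e in E) F e)
       (\big[op/idx]_(q <- s) F (step_edge q)).
Proof.
move=> k1; elim: s A E => [|q s IH] A E /=.
  move=> _ _; rewrite big_nil [RHS]Monoid.mulm1; apply: eq_bigl => e.
  by rewrite !inE in_nil orbF.
case/and4P=> h1 h2 /eqP h3 g sE.
have -> : E :|: [set e in step_edge q :: map (@step_edge V) s] =
    (step_edge q |: E) :|: [set e in map (@step_edge V) s].
  by apply/setP=> e; rewrite !inE; case: (e \in E); case: (e == _) => //=.
rewrite (IH _ _ g); last first.
  move=> e; rewrite !inE => /orP[/eqP->|/sE]; last first.
    by move=> h; exact: subset_trans h (subsetUl _ _).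
  by apply: setSU; rewrite sub1set.
rewrite big_cons big_setU1 /=; last first.
  apply/negP=> /sE /subsetP sA.
  have /card_gt0P[c cC] : 0 < #|q.2| by rewrite h3; case: (k) k1 => [|[]].
  have := disjointFl h2 cC; rewrite sA //.
  by rewrite /step_edge inE cC orbT.
by rewrite !Monoid.mulmA [op (F _) _]Monoid.mulmC.
Qed.

(** * Uniform hypertrees as growths from a root *)

Section Trees.
Variable G : hypergraph.
Implicit Types (v w : G) (s : seq (G * {set G})).

Lemma walk_cat v (q1 q2 : seq ({set G} * G)) :
  walk v (q1 ++ q2) = walk v q1 && walk (walk_end v q1) q2.
Proof.
elim: q1 v => [//|[e w] q1 IH] v /=.
by rewrite IH -!andbA.
Qed.

Lemma walk_end_cat v (q1 q2 : seq ({set G} * G)) :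
  walk_end v (q1 ++ q2) = walk_end (walk_end v q1) q2.
Proof. by rewrite /walk_end /unzip2 map_cat last_cat. Qed.

(** The distinctness and containment clauses are what is needed to close the walk to a Berge cycle
    by an edge outside [s]. *)
Lemma growth_path (r : G) s A v w :
  growth [set r] s A -> {subset map (@step_edge G) s <= edges G} ->
  v \in A -> w \in A ->
  exists q : seq ({set G} * G),
    [/\ walk v q, walk_end v q = w,
        {subset unzip1 q <= map (@step_edge G) s} /\
        {subset v :: unzip2 q <= A},
        uniq (unzip1 q) & uniq (v :: unzip2 q)].
Proof.
elim/last_ind: s A v w => [|s [p C] IH] A v w /=.
  move=> /eqP <- _; rewrite !inE => /eqP-> /eqP->; exists [::]; split=> //.
  by split=> // z; rewrite !inE.
move=> /growth_rcons[D [g /= pD dDC _ ->]] sE.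
rewrite map_rcons; set e := step_edge (p, C) in sE *.
have sE' : {subset map (@step_edge G) s <= edges G}.
  by move=> z zs; apply: sE; rewrite map_rcons mem_rcons inE zs orbT.
have eE : e \in edges G.
  by apply: sE; rewrite map_rcons mem_rcons inE eqxx.
have pe : p \in e by rewrite !inE eqxx.
have Ce z : z \in C -> z \in e by move=> zC; rewrite inE zC orbT.
have nDC z : z \in D -> z \in C -> False by move=> /(disjointFr dDC) ->.
have neD x : x \in C -> e \notin map (@step_edge G) s.
  move=> xC; apply/negP=> /(growth_edge_sub g) /subsetP /(_ x (Ce _ xC)) xD.
  exact: nDC xD xC.
have wid (q : seq ({set G} * G)) : {subset unzip1 q <= map (@step_edge G) s} ->
   {subset unzip1 q <= rcons (map (@step_edge G) s) e}.
  by move=> h z /h zs; rewrite mem_rcons inE zs orbT.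
rewrite !inE => /orP[vD|vC] /orP[wD|wC].
- have [q [h1 h2 [h3 h3'] h4 h5]] := IH _ _ _ g sE' vD wD.
  exists q; split=> //; split; first exact: wid.
  by move=> z /h3' zD; rewrite inE zD.
- have [q [h1 h2 [h3 h3'] h4 h5]] := IH _ _ _ g sE' vD pD.
  exists (rcons q (e, w)); rewrite -cats1; split.
  + by rewrite walk_cat h1 h2 /= eE pe Ce.
  + by rewrite walk_end_cat.
  + rewrite /unzip1 /unzip2 !map_cat; split=> z.
      by rewrite mem_cat mem_rcons !inE => /orP[/h3 ->|->]; rewrite ?orbT.
    rewrite -cat_cons mem_cat => /orP[/h3' zD|]; first by rewrite inE zD.
    by rewrite /= !inE => /eqP->; rewrite wC orbT.
  + rewrite /unzip1 map_cat cats1 rcons_uniq h4 andbT.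
    by apply/negP=> /h3; apply/negP/(neD w).
  + have : uniq (rcons (v :: unzip2 q) w).
      by rewrite rcons_uniq h5 andbT; apply/negP=> /h3' /nDC -/(_ wC).
    by rewrite -cats1 /unzip2 map_cat.
- have [q [h1 h2 [h3 h3'] h4 h5]] := IH _ _ _ g sE' pD wD.
  exists ((e, p) :: q); split.
  + by rewrite /= eE pe Ce.
  + by [].
  + split=> z.
      by rewrite mem_rcons !inE => /orP[->//|/h3 ->]; rewrite orbT.
    rewrite inE => /orP[/eqP->|/h3' zD]; first by rewrite inE vC orbT.
    by rewrite inE zD.
  + rewrite /= h4 andbT; apply/negP=> /h3; apply/negP/(neD v vC).
  + move: h5; rewrite !cons_uniq => ->; rewrite andbT.
    by apply/negP=> /h3' /nDC -/(_ vC).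
- have [<-|nvw] := eqVneq v w.
    exists [::]; split=> //; split=> // z; rewrite !inE => /eqP->.
    by rewrite vC orbT.
  exists [:: (e, w)]; split=> //=.
  + by rewrite eE !Ce.
  + split=> z; first by rewrite mem_rcons !inE => ->.
    by rewrite !inE => /orP[] /eqP->; rewrite ?vC ?wC orbT.
  + by rewrite inE nvw.
Qed.

Lemma growth_cycle (r : G) s A (e : {set G}) v w :
  acyclic G -> growth [set r] s A -> {subset map (@step_edge G) s <= edges G} ->
  e \in edges G -> e \notin map (@step_edge G) s ->
  v \in e -> w \in e -> v \in A -> w \in A -> v = w.
Proof.
move=> ac g sE eE es ve we vA wA.
have [//|nvw] := eqVneq v w; exfalso.
have [q [h1 h2 [h3 h3'] h4 h5]] := growth_path g sE vA wA.
apply: (ac v (rcons q (e, v))); rewrite -cats1; split.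
- rewrite size_cat addn1 ltnS; case: q h2 {h1 h3 h3' h4 h5} => //= h2.
  by move: nvw; rewrite -h2 eqxx.
- by rewrite walk_cat h1 h2 /= eE we ve.
- by rewrite walk_end_cat.
- rewrite /unzip1 map_cat cats1 rcons_uniq h4 andbT.
  by apply/negP=> /h3; apply/negP.
- by rewrite /unzip2 map_cat cats1 rcons_uniq -cons_uniq.
Qed.

Lemma walk_exit v (q : seq ({set G} * G)) (A : {set G}) :
  walk v q -> v \in A -> walk_end v q \notin A ->
  exists e, [/\ e \in edges G, exists2 x, x \in e & x \in A
                & exists2 y, y \in e & y \notin A].
Proof.
elim: q v => [|[e w] q IH] v /=; first by move=> _ ->.
case/and4P=> eE ve we wk vA en.
have [wA|wA] := boolP (w \in A); first exact: IH wk wA en.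
by exists e; split=> //; [exists v | exists w].
Qed.

(** While some vertex is not reached, connectedness yields an edge leaving the reached set [A], and
    acyclicity makes it a valid step. Once all vertices are reached, an edge outside [s] would join
    two of them and close a cycle. *)
Lemma hypertree_growth (r : G) :
  1 < k -> k_uniform k G -> hypertree G ->
  exists2 s, growth [set r] s setT & edges G = [set e in map (@step_edge G) s].
Proof.
move=> k1 uG [co ac].
suff [s g sE] : exists2 s, growth [set r] s setT
    & {subset map (@step_edge G) s <= edges G}.
  exists s => //; apply/setP=> e; rewrite inE.
  apply/idP/idP; last exact: sE.
  move=> eE; apply/negPn/negP=> es.
  have: 1 < #|e| by rewrite uG.
  case/card_gt1P=> x [y [xe ye /eqP]]; apply.
  by apply: (growth_cycle ac g sE eE es xe ye); rewrite inE.
suff H n A s : #|~: A| <= n -> growth [set r] s A ->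
    {subset map (@step_edge G) s <= edges G} ->
    exists2 s, growth [set r] s setT
      & {subset map (@step_edge G) s <= edges G}.
  by apply: (H _ _ [::] (leqnn _) (eqxx _)).
elim: n A s => [|n IH] A s.
  rewrite leqn0 cards_eq0 => /eqP AT g sE; exists s => //.
  by rewrite -(setCK A) AT setC0 in g.
move=> cA g sE.
have [/eqP AT|] := boolP (A == setT); first by rewrite AT in g; exists s.
rewrite -subTset => /subsetPn[v _ vA].
have rA : r \in A by apply: (subsetP (growth_sub g)); rewrite inE.
have [q [wq eq]] := co r v.
have [e [eE [x xe xA] [y ye yA]]] : exists e,
    [/\ e \in edges G, exists2 x, x \in e & x \in A
      & exists2 y, y \in e & y \notin A].
  by apply: (walk_exit wq rA); rewrite eq.
have es : e \notin map (@step_edge G) s.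
  by apply: contra yA => /(growth_edge_sub g) /subsetP ->.
(* By acyclicity [e] meets [A] only at [x], so it adds exactly [k.-1] vertices. *)
have eD : e :\: A = e :\ x.
  apply/setP=> z; rewrite !inE; case ze: (z \in e); rewrite ?andbF // !andbT.
  have [->|zx] := eqVneq z x; first by rewrite xA.
  apply/negP=> zA; move/eqP: zx; apply.
  exact: (growth_cycle ac g sE eE es ze xe zA xA).
apply: (IH (A :|: (e :\: A)) (rcons s (x, e :\: A))).
- rewrite -ltnS; apply: leq_trans cA; apply: proper_card.
  rewrite properE; apply/andP; split.
    by rewrite setCS subsetUl.
  by apply/subsetPn; exists y; rewrite !inE ?(negPf yA) ?ye.
- rewrite -cats1; apply: growth_cat g _ => /=.
  rewrite xA eqxx andbT /=; apply/andP; split.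
    by rewrite -setI_eq0 setIDA setD_eq0 subsetIl.
  by move: (cardsD1 x e); rewrite eD xe uG //= add1n => ->.
- move=> z; rewrite map_rcons mem_rcons inE => /orP[/eqP->|/sE //].
  by rewrite /step_edge /= eD setD1K.
Qed.

Lemma walk_sub v (q : seq ({set G} * G)) (D : {set G}) :
  {in unzip1 q, forall e : {set G}, e \subset D} -> walk v q -> 0 < size q ->
  v \in D /\ walk_end v q \in D.
Proof.
elim: q v => [//|[e w] q IH] v sD /= /and4P[eE ve we wq] _.
have eD : e \subset D by apply: sD; rewrite inE eqxx.
split; first exact: (subsetP eD).
case: q IH sD wq => [|a q] IH sD wq; first exact: (subsetP eD).
have sD' : {in unzip1 (a :: q), forall e : {set G}, e \subset D}.
  by move=> z zq; apply: sD; rewrite inE zq orbT.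
by case: (IH w sD' wq isT).
Qed.

(** Induction on the last step. If a cycle uses the last edge [e], the rest of it is a walk inside
    [D] between two vertices of [e]. As [e] meets [D] only in [p], both ends equal [p], which
    contradicts the distinctness of the vertices of the cycle. *)
Lemma growth_acyclic (r : G) s A v (q : seq ({set G} * G)) :
  growth [set r] s A -> {subset unzip1 q <= map (@step_edge G) s} ->
  ~ berge_cycle v q.
Proof.
elim/last_ind: s A v q => [|s [p C] IH] A v q /=.
  by move=> _ h [sz _ _ _ _]; case: q h sz => [|[e w] q] // /(_ e); rewrite !inE eqxx => /(_ isT).
move=> /growth_rcons[D [g /= pD dDC _ _]].
rewrite map_rcons; set e := step_edge (p, C) => sE cy.
have [eq|neq] := boolP (e \in unzip1 q); last first.
  apply: (IH _ v q g) cy => z zq; move: (sE z zq).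
  by rewrite mem_rcons inE => /orP[/eqP ez|//]; rewrite ez (negPf neq) in zq.
case/mapP: eq => -[e' x] qin /= ee; subst e'.
case: cy => sz wq en u1 u2.
case/splitPr: qin sE sz wq en u1 u2 => q1 q2 sE sz wq en u1 u2.
move: wq en; rewrite walk_cat walk_end_cat => /andP[w1 /=].
set y := walk_end v q1 => /and4P[eE ye xe w2].
rewrite [walk_end y _]/= => en.
have sz' : 0 < size (q2 ++ q1) by move: sz; rewrite !size_cat /= addnS ltnS addnC.
have wx : walk x (q2 ++ q1).
  rewrite walk_cat w2 /=; suff -> : walk_end x q2 = v by [].
  by rewrite -en.
have ex : walk_end x (q2 ++ q1) = y.
  by rewrite walk_end_cat [walk_end x q2]en.
have sD : {in unzip1 (q2 ++ q1), forall e : {set G}, e \subset D}.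
  move=> z zq; apply: (growth_edge_sub g).
  have : z \in e :: unzip1 (q2 ++ q1) by rewrite inE zq orbT.
  have zq' : z \in unzip1 (q1 ++ (e, x) :: q2).
    move: zq; rewrite /unzip1 !map_cat !mem_cat !inE.
    by case/orP=> ->; rewrite ?orbT.
  move: (sE z zq'); rewrite mem_rcons inE => /orP[/eqP ez|//].
  move: u1; rewrite /unzip1 map_cat uniq_catC /= => /andP[].
  by rewrite -map_cat -/(unzip1 _) -ez zq.
have [xD yD] := walk_sub sD wx sz'; rewrite ex in yD.
have inp z : z \in e -> z \in D -> z = p.
  rewrite inE in_set1 => /orP[/eqP//|zC] zD.
  by rewrite (disjointFr dDC zD) in zC.
have xp := inp _ xe xD; have yp := inp _ ye yD.
move: u2; rewrite /unzip2 map_cat uniq_catC /= => /andP[+ _].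
rewrite -map_cat => /negP; apply.
suff : walk_end x (q2 ++ q1) \in unzip2 (q2 ++ q1) by rewrite ex yp -xp.
rewrite /walk_end; case: (q2 ++ q1) sz' => [//|[e' z] q'] _ /=.
exact: mem_last.
Qed.

Lemma growth_hypertree (r : G) s :
  growth [set r] s setT -> edges G = [set e in map (@step_edge G) s] ->
  hypertree G.
Proof.
move=> g E; split.
  move=> u v; have [|q [h1 h2 _ _ _]] := @growth_path r s setT u v g _ (in_setT _) (in_setT _).
    by move=> z zs; rewrite E inE.
  by exists q.
move=> v q cy; apply: (growth_acyclic g) (cy).
case: cy => _ wq _ _ _; elim: q v wq => [//|[e w] q IH] v /= /and4P[eE _ _ /IH h] z.
by rewrite inE => /orP[/eqP->|/h //]; move: eE; rewrite E inE.
Qed.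

End Trees.
End Growth.

(** * Attached hypertrees and the hyperpath *)

Section CoalescenceGrowth.
Variables (k : nat) (G1 G2 : hypergraph) (v1 : G1) (v2 : G2).
Local Notation inL := (@coal_inl G1 G2 v2).
Local Notation inR := (@coal_inr G1 G2 v1 v2).

Lemma coal_inl_inj : injective inL.
Proof. by move=> x y []. Qed.

Lemma coal_inr_root : inR v2 = inL v1.
Proof. by rewrite /coal_inr insubF // eqxx. Qed.

Lemma coal_inr_inj : injective inR.
Proof.
move=> x y; rewrite /coal_inr.
case: (insubP _ x) => [x' _ <-|]; case: (insubP _ y) => [y' _ <-|] //.
- by move=> [->].
- by rewrite negbK => /eqP <-; rewrite negbK => /eqP <-.
Qed.

(** The growth from the root, carried over by [inR], starts at the identified vertex; [growth_frame]
    adds the rest of the copy of [G1] to its start. *)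
Lemma coal_growth t :
  growth k [set v2] t setT ->
  growth k (inL @: setT) (map (map_step inR) t) setT.
Proof.
move=> /(growth_map coal_inr_inj); rewrite imset_set1 coal_inr_root => g.
have := @growth_frame _ _ _ _ (inL @: setT) _ _ g.
have -> : [set inL v1] :|: inL @: setT = inL @: setT.
  by apply/setUidPr; rewrite sub1set imset_f.
have -> : inR @: setT :|: inL @: setT = setT.
  apply/setP=> -[x|y]; rewrite !inE; first by rewrite orbC (imset_f inL).
  apply/orP; left; apply/imsetP; exists (val y); rewrite ?inE //.
  by rewrite /coal_inr valK.
apply; rewrite -setI_eq0; apply/eqP/setP=> z; rewrite !inE.
apply/negP=> /and3P[/imsetP[x _ ->] xv /imsetP[y _]].
rewrite /coal_inr; case: insubP => // _ E.
by move: xv; rewrite E eqxx.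
Qed.

End CoalescenceGrowth.

(* G is the copy f of G0 together with the edges grown on it by s. *)
Definition grown (k : nat) (G0 G : hypergraph) (f : G0 -> G)
    (s : seq (G * {set G})) : Prop :=
  [/\ injective f, growth k (f @: setT) s setT &
      edges G = [set f @: e | e : {set G0} in edges G0]
                :|: [set e in map (@step_edge G) s]].

Lemma imset_edges_comp (V W X : finType) (g : W -> X) (f : V -> W)
    (E : {set {set V}}) :
  [set g @: e | e : {set W} in [set f @: e | e : {set V} in E]] =
  [set (g \o f) @: e | e : {set V} in E].
Proof. by rewrite -imset_comp; apply: eq_imset => e /=; rewrite -imset_comp. Qed.

Lemma imset_edges_seq (V W : finType) (g : V -> W) (s : seq (V * {set V})) :
  [set g @: e | e : {set V} in [set e in map (@step_edge V) s]] =
  [set e in map (@step_edge W) (map (map_step g) s)].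
Proof.
rewrite step_edge_map; apply/setP=> e; rewrite inE.
apply/imsetP/mapP => -[e' h ->]; exists e' => //; first by rewrite inE in h.
by rewrite inE.
Qed.

Lemma grown_coalescence (k : nat) (G0 G T : hypergraph) (f : G0 -> G) s
    (v : G) (r : T) t :
  grown k f s -> growth k [set r] t setT ->
  edges T = [set e in map (@step_edge T) t] ->
  @grown k G0 (coalescence v r) (fun x => coal_inl r (f x))
    (map (map_step (@coal_inl G T r)) s ++ map (map_step (coal_inr v r)) t).
Proof.
move=> [fi g E] gt Et; split.
- by move=> x y /coal_inl_inj /fi.
- apply: growth_cat (coal_growth v gt).
  have := growth_map (@coal_inl_inj G T r) g.
  by rewrite -imset_comp.
- rewrite /edges /= E imsetU imset_edges_comp imset_edges_seq Et imset_edges_seq.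
  rewrite -setUA; congr (_ :|: _).
  by apply/setP=> e; rewrite !inE map_cat mem_cat.
Qed.

Lemma grown_refl (k : nat) (G0 : hypergraph) :
  @grown k G0 G0 (fun v => v) [::].
Proof.
split=> //=; first by rewrite imset_id.
apply/setP=> e; rewrite !inE orbF; apply/idP/imsetP=> [h|[e' h ->]].
  by exists e; rewrite ?imset_id.
by rewrite imset_id.
Qed.

Lemma attached_grown (k : nat) (G0 G : hypergraph) (f : G0 -> G) :
  1 < k -> attached k f -> exists s, grown k f s.
Proof.
move=> k1; elim=> [|G' f' T u r _ [s gs] uT hT].
  by exists [::]; exact: grown_refl.
have [t gt Et] := hypertree_growth r k1 uT hT.
by eexists; exact: grown_coalescence gs gt Et.
Qed.

Lemma grown_card (k : nat) (G0 G : hypergraph) (f : G0 -> G) s :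
  1 < k -> grown k f s -> #|edges G| = #|edges G0| + size s.
Proof.
move=> k1 [fi g E]; rewrite E -sum1_card.
rewrite (growth_big_edge _ _ k1 g); last first.
  by move=> _ /imsetP[e _ ->]; apply: imsetS; exact: finset.subsetT.
rewrite [LHS]/= sum1_size sum1_card card_imset //; exact: imset_inj.
Qed.

Lemma attach_class_grown (k m : nat) (G0 G : hypergraph) :
  1 < k -> attach_class k m G0 G ->
  exists (f : G0 -> G) s, grown k f s /\ size s = m.
Proof.
move=> k1 [[G' [f [at_f [phi [[psi K1 K2] E]]]]] cE].
have [s [fi g E']] := attached_grown k1 at_f.
have psii : injective psi := can_inj K2.
have gr : grown k (psi \o f) (map (map_step psi) s).
  split.
  - by move=> x y /= /psii /fi.
  - have := growth_map psii g; rewrite -imset_comp.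
    suff -> : psi @: setT = setT by [].
    by apply/setP=> x; rewrite inE; apply/imsetP; exists (phi x).
  - rewrite -imset_edges_comp -imset_edges_seq -imsetU -E' E.
    rewrite imset_edges_comp -[LHS]imset_id; apply: eq_imset => e /=.
    rewrite -[RHS]imset_id -imset_comp; apply/setP=> x.
    apply/idP/imsetP=> [xe|[y ye ->]]; last by rewrite /= K1.
    by exists x => //=; rewrite K1.
exists (psi \o f), (map (map_step psi) s); split=> //.
by have /eqP := grown_card k1 gr; rewrite cE eqn_add2l => /eqP.
Qed.

(** * Hyperpaths as growths, unique up to isomorphism *)

Lemma exists_bij_pointed (V W : finType) (C : {set V}) (C' : {set W}) c c' :
  #|C| = #|C'| -> c \in C -> c' \in C' ->
  exists psi : V -> W,
    [/\ {in C &, injective psi}, psi @: C = C' & psi c = c'].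
Proof.
(* Elements are matched by their positions in the two enumerations; a transposition of [W] then
   moves the image of [c] to [c']. *)
move=> cE cC cC'; pose h x := nth c' (enum C') (index x (enum C)).
have sE : size (enum C) = size (enum C') by rewrite -!cardE.
have hin x : x \in C -> index x (enum C) < size (enum C').
  by move=> xC; rewrite -sE index_mem mem_enum.
have hC x : x \in C -> h x \in C'.
  by move=> xC; rewrite -mem_enum mem_nth // hin.
have hi : {in C &, injective h}.
  move=> x y xC yC /eqP; rewrite nth_uniq ?enum_uniq ?hin // => /eqP e.
  by rewrite -(nth_index c (_ : x \in enum C)) ?mem_enum // e nth_index ?mem_enum.
have pi : {in C &, injective (fun x => tperm (h c) c' (h x))}.
  by move=> x y xC yC /perm_inj; exact: hi.
exists (fun x => tperm (h c) c' (h x)); split=> //; last exact: tpermL.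
apply/eqP; rewrite eqEcard card_in_imset // cE leqnn andbT.
apply/subsetP=> _ /imsetP[x xC ->].
by case: tpermP => // _; [exact: hC | move=> _; exact: hC].
Qed.

(** Together with [growth] this describes a hyperpath leaving [P]: every later edge hangs at a new
    vertex of its predecessor. *)
Fixpoint pathlike (V : finType) (P : {set V}) (s : seq (V * {set V})) : bool :=
  if s is q :: s' then (q.1 \in P) && pathlike q.2 s' else true.

Lemma pathlike_map (V W : finType) (h : V -> W) (P : {set V}) s :
  pathlike P s -> pathlike (h @: P) (map (map_step h) s).
Proof.
elim: s P => [//|q s IH] P /= /andP[qP /IH ->].
by rewrite imset_f.
Qed.

Lemma pathlike_head (V : finType) (P : {set V}) s d :
  d \in P -> pathlike P s -> head d (unzip1 s) \in P.
Proof. by case: s => [//|q s] /= _ /andP[]. Qed.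

(** The map is extended one edge at a time. On the new vertices any bijection will do, provided that
    it sends the vertex where the next edge hangs to its counterpart; the condition on [head]
    carries this through the induction. *)
Lemma growth_pathlike_iso (k : nat) (V W : finType) (phi : V -> W)
    (A B P : {set V}) (A' B' P' : {set W}) s t d d' :
  1 < k -> growth k A s B -> growth k A' t B' -> size s = size t ->
  pathlike P s -> pathlike P' t ->
  {in A &, injective phi} -> phi @: A = A' ->
  phi (head d (unzip1 s)) = head d' (unzip1 t) ->
  exists phi' : V -> W,
    [/\ {in A, phi' =1 phi}, {in B &, injective phi'}, phi' @: B = B' &
        map (fun e : {set V} => phi' @: e) (map (@step_edge V) s)
          = map (@step_edge W) t].
Proof.
move=> k1; elim: s t phi A A' P P' d d' => [|q s IH] [|q' t] //=
  phi A A' P P' d d'.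
  by move=> /eqP <- /eqP <- _ _ _ pi pA _; exists phi; split.
case/and4P=> qA dA /eqP cC g /and4P[q'A dA' /eqP cC' g'] [sz].
case/andP=> qP ps /andP[q'P' pt] pi pA pq.
have [c cinC] : exists c, c \in q.2.
  by apply/card_gt0P; rewrite cC; case: (k) k1 => [|[]].
have [c' cinC'] : exists c, c \in q'.2.
  by apply/card_gt0P; rewrite cC'; case: (k) k1 => [|[]].
have [psi [psii psiC psic]] := exists_bij_pointed (etrans cC (esym cC'))
  (pathlike_head cinC ps) (pathlike_head cinC' pt).
pose ph v := if v \in q.2 then psi v else phi v.
have phA : {in A, ph =1 phi} by move=> v vA; rewrite /ph (disjointFr dA vA).
have phC : {in q.2, ph =1 psi} by move=> v vC; rewrite /ph vC.
have phAi : ph @: A = A' by rewrite -pA; apply: eq_in_imset.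
have phCi : ph @: q.2 = q'.2 by rewrite -psiC; apply: eq_in_imset.
have phN x y : x \in A -> y \in q.2 -> ph x <> ph y.
  move=> xA yC e; have : ph x \in A' by rewrite -phAi imset_f.
  by move/(disjointFr dA'); rewrite e -phCi imset_f.
have phi_inj : {in A :|: q.2 &, injective ph}.
  move=> x y; rewrite !inE => /orP[xA|xC] /orP[yA|yC].
  - by rewrite !phA //; exact: pi.
  - by move/phN; case.
  - by move/esym/phN; case.
  - by rewrite !phC //; exact: psii.
have [||phi' [e1 e2 e3 e4]] := IH t ph _ (A' :|: q'.2) q.2 q'.2 c c' g g' sz ps pt phi_inj.
- by rewrite imsetU phAi phCi.
- by rewrite phC // pathlike_head.
exists phi'; split=> //.
- by move=> v vA; rewrite e1 ?inE ?vA // phA.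
- rewrite e4; congr (_ :: _); rewrite /step_edge imsetU1 e1 ?inE ?qA //.
  rewrite phA // pq; congr (_ |: _); rewrite -phCi.
  by apply: eq_in_imset => v vC; rewrite e1 // inE vC orbT.
Qed.

Lemma grown_pathlike_iso (k : nat) (G0 G H : hypergraph) (f : G0 -> G)
    (g : G0 -> H) s t u :
  1 < k -> grown k f s -> grown k g t -> size s = size t ->
  pathlike [set f u] s -> pathlike [set g u] t -> isomorphic G H.
Proof.
move=> k1 [fi gs Es] [gi gt Et] sz ps pt.
pose f' v := if [pick x | f x == v] is Some x then g x else g u.
have f'f x : f' (f x) = g x.
  rewrite /f'; case: pickP => [y /eqP/fi -> //|/(_ x)].
  by rewrite eqxx.
have [||| phi [e1 e2 e3 e4]] := @growth_pathlike_iso k _ _ f' _ _ _ _ _ _ _ _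
    (f u) (g u) k1 gs gt sz ps pt.
- by move=> _ _ /imsetP[x _ ->] /imsetP[y _ ->]; rewrite !f'f => /gi ->.
- by rewrite -imset_comp; apply: eq_imset.
- have := pathlike_head (set11 (f u)) ps; have := pathlike_head (set11 (g u)) pt.
  by rewrite !inE => /eqP -> /eqP ->.
have phii : injective phi by move=> x y; apply: e2; rewrite inE.
have phis : #|H| <= #|G|.
  by rewrite -!cardsT -e3 leq_imset_card.
exists phi; split; first exact: inj_card_bij.
rewrite Et Es imsetU imset_edges_comp; congr (_ :|: _).
  apply: eq_imset => e; apply: eq_imset => x /=.
  by rewrite e1 ?f'f // imset_f.
rewrite imset_edges_seq; congr (finset _); apply: boolp.funext => e.
by rewrite -e4 step_edge_map.
Qed.

Section HyperpathGrowth.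
Variables (k m : nat).
Hypothesis k1 : 1 < k.
Local Notation P := (hyperpath_vertex k m).

(** The vertices reached before the edge with index [i]; [hyperpath_new i] consists of those which
    that edge adds. *)
Definition hyperpath_initial (i : nat) : {set P} :=
  [set w : P | match w with inl j => j <= i | inr p => p.1 < i end].

Definition hyperpath_new (i : nat) : {set P} :=
  [set w : P | match w with inl j => j == i.+1 :> nat | inr p => p.1 == i :> nat end].

Definition hyperpath_step (i : nat) : P * {set P} :=
  (inl (inord i), hyperpath_new i).

Lemma card_hyperpath_new i : i < m -> #|hyperpath_new i| = k.-1.
Proof.
move=> im.
have -> : hyperpath_new i =
    inl (inord i.+1) |: [set inr (Ordinal im, j) | j in setT].
  apply/setP=> -[j|[a j]]; rewrite !inE.
    have -> : (inl j \in [set (inr (Ordinal im, j0) : P) | j0 in setT]) = false.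
      by apply/negP=> /imsetP[].
    rewrite orbF; apply/eqP/eqP=> [e|[->]]; last by rewrite inordK.
    by congr (inl _); apply: val_inj; rewrite /= inordK.
  apply/eqP/imsetP=> [/= e|[j' _ [-> _]] //].
  by exists j; rewrite ?inE //; congr (inr (_, _)); exact: val_inj.
rewrite cardsU1 card_imset; last by move=> x y [].
rewrite cardsT card_ord; case: imsetP => [[]//|_].
by rewrite /= add1n subn2; case: (k) k1 => [|[]].
Qed.

Lemma hyperpath_growth_from n i : i + n = m ->
  growth k (hyperpath_initial i) [seq hyperpath_step j | j <- iota i n] setT.
Proof.
elim: n i => [|n IH] i /= e.
  rewrite addn0 in e; apply/eqP/setP=> -[j|p]; rewrite !inE e.
    by rewrite -ltnS ltn_ord.
  by rewrite ltn_ord.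
have im : i < m by rewrite -e addnS ltnS leq_addr.
rewrite card_hyperpath_new // eqxx.
have -> : inl (inord i) \in hyperpath_initial i.
  by rewrite inE inordK // ltnW.
have -> : [disjoint hyperpath_initial i & hyperpath_new i].
  rewrite -setI_eq0; apply/eqP/setP=> -[j|p]; rewrite !inE.
    by apply/negP=> /andP[h /eqP h']; rewrite h' ltnn in h.
  by apply/negP=> /andP[h /eqP h']; rewrite h' ltnn in h.
have -> : hyperpath_initial i :|: hyperpath_new i = hyperpath_initial i.+1.
  apply/setP=> -[j|p]; rewrite !inE; first by rewrite [RHS]leq_eqVlt orbC ltnS.
  by rewrite ltnS [RHS]leq_eqVlt orbC.
by apply: IH; rewrite addSnnS.
Qed.

Lemma hyperpath_growth :
  growth k [set inl ord0] [seq hyperpath_step j | j <- iota 0 m] setT.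
Proof.
have := @hyperpath_growth_from m 0 (add0n m).
suff -> : hyperpath_initial 0 = [set inl ord0] by [].
apply/setP=> -[j|p]; rewrite !inE //.
by rewrite leqn0; apply/eqP/eqP=> [e|[->] //]; congr (inl _); apply: val_inj.
Qed.

Lemma hyperpath_step_edge (i : 'I_m) :
  step_edge (hyperpath_step i) = hyperpath_edge k i.
Proof.
apply/setP=> -[j|p]; rewrite !inE //=.
congr (_ || _); apply/eqP/eqP => [[->]|e].
  by rewrite inordK // ltnW // ltnS ltn_ord.
by congr (inl _); apply: val_inj; rewrite /= inordK // ltnW // ltnS ltn_ord.
Qed.

Lemma hyperpath_edges :
  edges (hyperpath k m) =
  [set e in map (@step_edge P) [seq hyperpath_step j | j <- iota 0 m]].
Proof.
apply/setP=> e; rewrite inE -map_comp; apply/imsetP/mapP=> [[i _ ->]|[i]].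
  by exists (val i); rewrite ?mem_iota ?ltn_ord //= hyperpath_step_edge.
rewrite mem_iota => im ->; exists (Ordinal im) => //=.
by rewrite -hyperpath_step_edge.
Qed.

Lemma hyperpath_pathlike_from n i (Q : {set P}) :
  i + n <= m -> (inl (inord i) \in Q) ->
  pathlike Q [seq hyperpath_step j | j <- iota i n].
Proof.
elim: n i Q => [//|n IH] i Q le iQ /=; rewrite iQ /=.
rewrite addnS -addSn in le; apply: IH => //.
by rewrite inE inordK // ltnS (leq_trans _ le) // leq_addr.
Qed.

Lemma hyperpath_pathlike :
  pathlike [set inl ord0] [seq hyperpath_step j | j <- iota 0 m].
Proof.
apply: hyperpath_pathlike_from => //; rewrite inE; apply/eqP.
by congr (inl _); apply: val_inj; rewrite /= inordK.
Qed.

Lemma hyperpath_uniform : k_uniform k (hyperpath k m).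
Proof.
move=> e; rewrite hyperpath_edges inE.
by apply: growth_card hyperpath_growth; exact: ltnW.
Qed.

Lemma hyperpath_hypertree : hypertree (hyperpath k m).
Proof.
exact: (@growth_hypertree k (hyperpath k m) (inl ord0) _ hyperpath_growth
  hyperpath_edges).
Qed.

Lemma hyperpath_pendent : 0 < m ->
  pendent_vertex k (inl ord0 : hyperpath k m).
Proof.
move=> m0; pose i0 := Ordinal m0.
have deg1 (w : hyperpath k m) : w \in hyperpath_edge k i0 ->
    (forall i : 'I_m, w \in hyperpath_edge k i -> i = i0) -> degree w = 1.
  move=> h1 h2; rewrite /degree; apply/eqP/cards1P.
  exists (hyperpath_edge k i0); apply/setP=> e; rewrite !inE.
  apply/andP/eqP=> [[/imsetP[i _ ->] /h2 -> //]|->].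
  by rewrite imset_f.
have in0 : inl ord0 \in hyperpath_edge k i0 by rewrite inE.
have d0 : degree (inl ord0 : hyperpath k m) = 1.
  apply: deg1 => // i; rewrite inE => /orP[] /eqP //= e.
  by apply: val_inj; rewrite /= -e.
split=> //; exists (hyperpath_edge k i0); split=> //.
rewrite /pendent_edge imset_f //=.
have cE : #|hyperpath_edge k i0| = k.
  by apply: hyperpath_uniform; rewrite imset_f.
have ord1 : 1 < m.+1 by [].
(* Every vertex of the first edge, except possibly [inl 1], has degree one. *)
rewrite leq_subLR -{1}cE -[X in _ <= X + _](cards1 (inl (Ordinal ord1) : P)).
apply: leq_trans (leq_card_setU _ _); apply: subset_leq_card.
apply/subsetP=> -[j|p]; rewrite !inE.
  case/orP=> /eqP e.
    have -> : j = ord0 by exact: val_inj.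
    by rewrite d0 eqxx orbT.
  by apply/orP; left; apply/eqP; congr (inl _); exact: val_inj.
move=> /eqP e; rewrite e eqxx /=; apply/eqP; apply: deg1.
  by rewrite inE e.
by move=> i; rewrite inE e => /eqP.
Qed.

End HyperpathGrowth.

Section PathAttached.
Variables (k m : nat) (G0 : hypergraph) (u : G0).
Hypothesis k1 : 1 < k.
Local Notation w := (inl ord0 : hyperpath k m).

Let grown_w := @grown_coalescence k G0 G0 (hyperpath k m) (fun v => v) [::] u w _
  (grown_refl k G0) (@hyperpath_growth k m k1) (@hyperpath_edges k m).

Lemma attach_class_hyperpath : attach_class k m G0 (coalescence u w).
Proof.
split.
  exists (coalescence u w), (fun v => coal_inl w v); split.
    apply: (@attached_step k G0 G0 (fun v => v)); first exact: attached_refl.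
      exact: hyperpath_uniform.
    exact: hyperpath_hypertree.
  exists id; split; first by exists id.
  apply/setP=> e; apply/idP/imsetP=> [h|[e' h ->]].
    by exists e; rewrite ?imset_id.
  by rewrite imset_id.
by rewrite (grown_card k1 grown_w) /= !size_map size_iota.
Qed.

Lemma hyperpath_grown : exists t,
  [/\ @grown k G0 (coalescence u w) (coal_inl w) t, size t = m &
      pathlike [set coal_inl w u] t].
Proof.
eexists; split; first exact: grown_w.
  by rewrite /= !size_map size_iota.
have := pathlike_map (coal_inr u w) (hyperpath_pathlike k m).
by rewrite imset_set1 coal_inr_root.
Qed.

End PathAttached.

(** * The form of the signless Laplacian and its least eigenvalue *)

Local Open Scope ring_scope.

Section QuadraticForm.
Variables (R : realType) (k : nat) (G : hypergraph).
Hypothesis k1 : (1 < k)%N.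
Implicit Type x : G -> R.

(* The paper's x_e^k + k x^e. *)
Definition edge_form x (e : {set G}) : R :=
  \sum_(v in e) x v ^+ k + k%:R * \prod_(v in e) x v.

Definition slap_form x : R := \sum_(e in edges G) edge_form x e.

(** For even [k] this is the [k]-th power of the usual [k]-norm, hence no absolute values. *)
Definition knorm x : R := \sum_(v : G) x v ^+ k.

(** For uniform [G], the component at [v] of the adjacency tensor applied to [x]. *)
Definition link_sum x v : R :=
  \sum_(e in edges G | v \in e) \prod_(w in e :\ v) x w.

Hypothesis uG : k_uniform k G.

(** As [e] has [k] vertices, such a tuple lists the other vertices of [e] without repetition. The
    count cancels the factor in the adjacency tensor. *)
Lemma card_link_tuples (e : {set G}) v : e \in edges G -> v \in e ->
  #|[set t : k.-1.-tuple G | [set w in v :: t] == e]| = k.-1`!.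
Proof.
move=> eE ve.
have cE : #|e :\ v| = k.-1 by have := cardsD1 v e; rewrite ve uG // => ->.
transitivity (#|e :\ v| ^_ k.-1)%N; last by rewrite cE ffactnn.
rewrite -card_uniq_tuples; apply: eq_card => t; rewrite !inE.
apply/eqP/andP=> [se|[/allP al un]].
  have un : uniq (v :: t).
    apply/card_uniqP; rewrite /= size_tuple prednK; last exact: ltnW.
    by rewrite -[RHS](uG eE) -se cardsE.
  move: (un) => /= /andP[vt ->]; split=> //.
  apply/allP=> w wt; apply/setD1P; rewrite -se inE inE wt orbT; split=> //.
  by apply: contraNneq vt => <-.
apply/eqP; rewrite eqEcard uG // cardsE; apply/andP; split.
  apply/subsetP=> w; rewrite !inE => /orP[/eqP-> //|].
  by move=> /al /setD1P[].
have /card_uniqP -> : uniq (v :: t).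
  rewrite /= un andbT; by apply/negP=> /al /setD1P[/eqP].
by rewrite /= size_tuple prednK // ltnW.
Qed.

Lemma prod_link_tuple (e : {set G}) v (t : k.-1.-tuple G) x :
  e \in edges G -> [set w in v :: t] = e ->
  \prod_(i < k.-1) x (tnth t i) = \prod_(w in e :\ v) x w.
Proof.
move=> eE se.
have un : uniq (v :: t).
  apply/card_uniqP; rewrite /= size_tuple prednK; last exact: ltnW.
  by rewrite -[RHS](uG eE) -se cardsE.
move: (un) => /= /andP[vt ut].
rewrite -(big_tuple _ _ t xpredT x) big_uniq //=; apply: eq_bigl => w.
rewrite !inE -se !inE; have [->|//] := eqVneq w v.
exact: negbTE.
Qed.

Lemma signless_laplacian_apply (x : {ffun G -> R}) v :
  tensor_apply (@signless_laplacian R k G) x v =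
  (degree v)%:R * x v ^+ k.-1 + link_sum x v.
Proof.
rewrite /tensor_apply /signless_laplacian.
under eq_bigr do rewrite mulrDl.
rewrite big_split /=; congr (_ + _).
  rewrite (bigD1 (nseq_tuple k.-1 v)) //= [X in _ + X]big1 ?addr0.
    rewrite /degree_tensor /= all_pred1_nseq theadE; congr (_ * _).
    under eq_bigr do rewrite tnth_nseq.
    by rewrite prodr_const card_ord.
  move=> t tn; rewrite /degree_tensor /=; case: ifP => [/all_pred1P e|]; last by rewrite mul0r.
  by case/eqP: tn; apply: val_inj; rewrite /= e size_tuple.
rewrite /adjacency_tensor /=; pose S (t : k.-1.-tuple G) := [set w in v :: t].
rewrite (eq_bigr (fun t => if S t \in edges G then
    (k.-1`!%:R)^-1 * \prod_(i < k.-1) x (tnth t i) else 0)); last first.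
  by move=> t _; rewrite /S; case: ifP => // _; rewrite mul0r.
rewrite -big_mkcond /=.
(* The tuples are grouped by the edge that they form with [v]. *)
rewrite (partition_big S (fun e => (e \in edges G) && (v \in e))); last first.
  by move=> t ->; rewrite /S !inE eqxx.
apply: eq_bigr => e /andP[eE ve].
rewrite (eq_bigr (fun=> (k.-1`!%:R)^-1 * \prod_(w in e :\ v) x w)); last first.
  by move=> t /andP[_ /eqP se]; rewrite (prod_link_tuple x eE se).
rewrite (eq_bigl (mem [set t | S t == e])); last first.
  move=> t; rewrite !inE; apply/andP/idP => [[]//|/eqP se].
  by rewrite se eqxx eE.
rewrite sumr_const card_link_tuples // -[in RHS](mul1r (\prod_(_ in _) _)).
by rewrite -mulrnAl -mulr_natr mulVf // pnatr_eq0 -lt0n fact_gt0.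
Qed.

Lemma prod_link_mul x (e : {set G}) v :
  v \in e -> x v * \prod_(w in e :\ v) x w = \prod_(w in e) x w.
Proof. by move=> ve; rewrite -(big_setD1 v ve). Qed.

Lemma degree_mul (v : G) (a : R) :
  (degree v)%:R * a = \sum_(e in edges G | v \in e) a.
Proof.
rewrite /degree mulr_natl -sumr_const; apply: eq_bigl => e.
by rewrite !inE.
Qed.

(** Euler's identity for a form of degree [k]: the bracket is the partial derivative at [v] divided
    by [k]. *)
Lemma slap_form_gradient x :
  \sum_v x v * ((degree v)%:R * x v ^+ k.-1 + link_sum x v) = slap_form x.
Proof.
under eq_bigr => v _.
  rewrite mulrDr mulrCA -exprS prednK; last exact: ltnW.
  rewrite degree_mul /link_sum mulr_sumr -big_split /=.
  under eq_bigr => e /andP[_ ve] do rewrite prod_link_mul //.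
  over.
rewrite (exchange_big_dep (mem (edges G))) /=; last by move=> v e _ /andP[].
apply: eq_bigr => e eE; rewrite /edge_form.
rewrite (eq_bigl (mem e)); last by move=> v; rewrite eE.
by rewrite big_split /= sumr_const uG // mulr_natl.
Qed.

Lemma H_eigenpair_form (mu : R) (x : {ffun G -> R}) :
  (forall v, tensor_apply (@signless_laplacian R k G) x v = mu * x v ^+ k.-1) ->
  slap_form x = mu * knorm x.
Proof.
move=> ev; rewrite -slap_form_gradient /knorm mulr_sumr; apply: eq_bigr => v _.
by rewrite -signless_laplacian_apply ev mulrCA -exprS prednK // ltnW.
Qed.

Definition update x v (z : R) : G -> R := fun w => if w == v then z else x w.

Lemma knorm_update x v z :
  knorm (update x v z) = knorm x + (z ^+ k - x v ^+ k).
Proof.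
rewrite /knorm (bigD1 v) // [in RHS](bigD1 v) //= /update eqxx.
under eq_bigr => w /negPf wv do rewrite wv.
by rewrite addrAC addrCA subrr addr0.
Qed.

(** The product over an edge is linear in each entry, so in one entry the form is a multiple of the
    [k]-th power plus an affine term. *)
Lemma slap_form_update x v z :
  slap_form (update x v z) = slap_form x +
    ((degree v)%:R * (z ^+ k - x v ^+ k) + k%:R * (z - x v) * link_sum x v).
Proof.
rewrite degree_mul /link_sum mulr_sumr -big_split /=.
rewrite big_mkcondr /= -big_split /=; apply: eq_bigr => e eE; rewrite /edge_form.
case: ifP => ve; last first.
  have ex w : w \in e -> update x v z w = x w.
    by rewrite /update; case: eqVneq => [->|//]; rewrite ve.
  rewrite addr0; congr (_ + _ * _); apply: eq_bigr => w we; rewrite ex //.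
rewrite !(big_setD1 v ve) /= /update eqxx.
under eq_bigr => w; first by rewrite !inE => /andP[/negPf wv _]; rewrite wv; over.
under [in X in _ + k%:R * (_ * X) = _]eq_bigr => w; first by rewrite !inE => /andP[/negPf wv _]; rewrite wv; over.
by ring.
Qed.

End QuadraticForm.

(** * Variational characterization of the least H-eigenvalue *)

Import numFieldNormedType.Exports.

(** The first-order condition at [z = y], where the bounded function attains its minimum 0. *)
Lemma stationary_power (R : realType) (k : nat) (c b y : R) :
  (forall z : R, 0 <= c * (z ^+ k - y ^+ k) + b * (z - y)) ->
  c * (k%:R * y ^+ k.-1) + b = 0.
Proof.
move=> h; pose f (z : R) : R := c * (z ^+ k - y ^+ k) + b * (z - y).
have df (z : R) : is_derive z (1 : R) f (c * (k%:R * z ^+ k.-1) + b).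
  have -> : f = c \*: ((id : R -> R) ^+ k - cst (y ^+ k))
                + b \*: ((id : R -> R) - cst y).
    by apply: funext => t; rewrite /f !fctE.
  apply: is_derive_eq.
  by rewrite !subr0 /GRing.scale /= !mulr1.
have dmin : is_derive y (1 : R) f 0.
  apply: (@derive1_at_min R f (y - 1) (y + 1)).
  - lra.
  - by move=> t _; apply: ex_derive.
  - by rewrite in_itv /=; apply/andP; split; lra.
  - by move=> t _; rewrite /f !subrr !mulr0 addr0.
have := @derive_val _ _ _ _ _ _ _ dmin.
by rewrite (@derive_val _ _ _ _ _ _ _ (df y)).
Qed.

Section LeastEigenvalue.
Variables (R : realType) (k : nat) (G : hypergraph).
Hypotheses (k1 : (1 < k)%N) (kE : ~~ odd k) (uG : k_uniform k G).

Lemma knorm_ge0 (x : G -> R) : 0 <= knorm k x.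
Proof. by apply: sumr_ge0 => v _; rewrite exprn_even_ge0. Qed.

Lemma knorm_eq0 (x : G -> R) : knorm k x = 0 -> forall v, x v = 0.
Proof.
move=> /eqP; rewrite psumr_eq0 => [/allP h v|v _]; last by rewrite exprn_even_ge0.
have /implyP/(_ isT) := h v (mem_index_enum v).
by rewrite expf_eq0 => /andP[_ /eqP].
Qed.

(** The unit sphere of the [k]-norm is closed in the cube with sides from -1 to 1, hence compact,
    and the form is continuous. Vectors are coded as row matrices to use the topology there; [v0]
    makes the sphere nonempty. *)
Lemma slap_form_minimizer (v0 : G) : exists x : G -> R,
  knorm k x = 1 /\ forall y : G -> R, knorm k y = 1 -> slap_form k x <= slap_form k y.
Proof.
pose n := #|G|; pose fn (r : 'rV[R]_n) : G -> R := fun v => r ord0 (enum_rank v).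
have cfn v : continuous (fun r => fn r v) by exact: coord_continuous.
have cX (f : 'rV[R]_n -> R) j : continuous f -> continuous (fun r => f r ^+ j).
  by move=> cf r; apply: (@continuous_comp _ _ _ f (@GRing.exp R ^~ j)); [exact: cf | exact: exprn_continuous].
have cN : continuous (fun r => knorm k (fn r)).
  by apply: (@continuous_big R _ +%R 0 _ (@add_continuous R^o)) => v _; exact: cX.
have cS (e : {set G}) : continuous (fun r => \sum_(v in e) fn r v ^+ k).
  by apply: (@continuous_big R _ +%R 0 _ (@add_continuous R^o)) => v _; exact: cX.
have cP (e : {set G}) : continuous (fun r => \prod_(v in e) fn r v).
  by apply: (@continuous_big R _ *%R 1 _ (@mul_continuous R)) => v _; exact: cfn.
have cQ : continuous (fun r => slap_form k (fn r)).
  apply: (@continuous_big R _ +%R 0 _ (@add_continuous R^o)) => e _ r.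
  exact: (cvgD (cS e r) (cvgM (cvg_cst _) (cP e r))).
pose S := ([set r : 'rV[R]_n | forall i, (`[(-1), 1]%classic : set R) (r ord0 i)]
          `&` [set r | knorm k (fn r) = 1])%classic.
have cptS : compact S.
  apply: compact_closedI.
    exact: (@rV_compact R n (fun=> `[(-1), 1]%classic) (fun=> @segment_compact R (-1) 1)).
  exact: (@preimage_closed _ R (fun r => knorm k (fn r)) _ (fun r _ => cN r) (@closed_eq R 1)).
have nS (y : G -> R) : knorm k y = 1 -> S (\row_i y (enum_val i)) /\
    fn (\row_i y (enum_val i)) = y.
  move=> Ny.
  have fy : fn (\row_i y (enum_val i)) = y.
    by apply: funext => v; rewrite /fn mxE enum_rankK.
  split=> //; split; last by rewrite /= fy.
  move=> i /=; rewrite mxE in_itv /= -ler_norml.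
  rewrite -(@ler_pXn2r _ k) ?nnegrE // ?(ltnW k1) // expr1n -normrX ger0_norm ?exprn_even_ge0 //.
  rewrite -Ny /knorm (bigD1 (enum_val i)) //= lerDl.
  by apply: sumr_ge0 => w _; rewrite exprn_even_ge0.
have S0 : (S !=set0)%classic.
  pose y v : R := (v == v0)%:R.
  have Ny : knorm k y = 1.
    rewrite /knorm (bigD1 v0) //= /y eqxx expr1n big1 ?addr0 // => v /negPf ->.
    by rewrite expr0n; case: (k) k1.
  by exists (\row_i y (enum_val i)); case: (nS y Ny).
have [r rS rmin] := EVT_min_rV S0 cptS (continuous_subspaceT cQ).
exists (fn r); split; first by case: (set_mem rS).
move=> y /nS [yS fy]; rewrite -fy; by apply: rmin; exact: mem_set.
Qed.

(** The minimum of the form on the unit sphere is an eigenvalue by stationarity, and every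
    eigenvalue is a value of the Rayleigh quotient, hence not smaller. *)
Lemma lambda_min_rayleigh (v0 : G) :
  exists mu : R, is_lambda_min k G mu /\
    forall y : G -> R, mu * knorm k y <= slap_form k y.
Proof.
have [x [Nx xmin]] := slap_form_minimizer v0.
have k0 : (0 < k)%N by exact: ltnW.
pose mu := slap_form k x.
have scale (y : G -> R) a : knorm k (fun v => a * y v) = a ^+ k * knorm k y /\
    slap_form k (fun v => a * y v) = a ^+ k * slap_form k y.
  split.
    by rewrite /knorm mulr_sumr; apply: eq_bigr => v _; rewrite exprMn.
  rewrite /slap_form mulr_sumr; apply: eq_bigr => e eE; rewrite /edge_form.
  rewrite mulrDr mulr_sumr big_split /= prodr_const uG // mulrCA; congr (_ + _).
  by apply: eq_bigr => v _; rewrite exprMn.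
have ray (y : G -> R) : mu * knorm k y <= slap_form k y.
  have [N0|N0] := eqVneq (knorm k y) 0.
    have y0 := knorm_eq0 N0.
    have [_] := scale y 0; rewrite (_ : (fun v => _) = y) => [->|]; last first.
      by apply: funext => v; rewrite y0 mulr0.
    by rewrite N0 mulr0 expr0n; case: (k) k0 => //= *; rewrite mul0r.
  have Np : 0 < knorm k y by rewrite lt_neqAle eq_sym N0 knorm_ge0.
  (* Scaling by [a] brings [y] to norm one; the form and [knorm] are both homogeneous of degree
     [k]. *)
  pose a := (knorm k y)^-1 `^ (k%:R^-1).
  have ak : a ^+ k = (knorm k y)^-1.
    rewrite -powR_mulrn ?powR_ge0 // -powRrM mulVf ?pnatr_eq0 -?lt0n //.
    by rewrite powRr1 // invr_ge0 ltW.
  have [sN sQ] := scale y a.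
  have := xmin (fun v => a * y v); rewrite sN sQ ak mulVf // => /(_ erefl).
  by rewrite ler_pdivlMl // mulrC.
have eig : H_eigenvalue (@signless_laplacian R k G) mu.
  exists (finfun x); split.
    apply/eqP => x0; have : knorm k x = 0.
      rewrite /knorm big1 // => v _; have /ffunP/(_ v) := x0.
      by rewrite !ffunE => ->; rewrite expr0n; case: (k) k0.
    by rewrite Nx => /eqP; rewrite oner_eq0.
  have -> : (finfun x : G -> R) = x by apply: funext => v; rewrite ffunE.
  move=> v; rewrite signless_laplacian_apply //.
  have fx : (finfun x : G -> R) = x by apply: funext => w; rewrite ffunE.
  rewrite fx.
  (* Only the entry at [v] varies; equality holds at [z = x v], so stationarity there is the
     eigenvalue equation at [v]. *)
  have st z : 0 <= ((degree v)%:R - mu) * (z ^+ k - x v ^+ k)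
               + (k%:R * link_sum x v) * (z - x v).
    have := ray (update x v z).
    by rewrite knorm_update slap_form_update // -subr_ge0 Nx /mu => h; lra.
  have kn : (k%:R : R) != 0 by rewrite pnatr_eq0 -lt0n.
  apply: (mulfI kn); have := stationary_power st; lra.
exists mu; split=> //; split=> // nu [y [y0 ey]].
have := ray y; rewrite (H_eigenpair_form k1 uG ey) ler_pM2r //.
rewrite lt_neqAle knorm_ge0 andbT eq_sym; apply: contra y0 => /eqP /knorm_eq0 y0.
by apply/eqP/ffunP => v; rewrite ffunE y0.
Qed.

End LeastEigenvalue.

(** * Truncation *)

Section Truncation.
Variables (R : realType) (k : nat).
Hypothesis k1 : (1 < k)%N.
Let k0 : (0 < k)%N := ltnW k1.
Let kR0 : 0 < k%:R :> R. Proof. by rewrite ltr0n. Qed.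

Section Edge.
Variable V : finType.
Implicit Types (X : V -> R) (e : {set V}) (s : R).

(* The value of the edge form on nonnegative entries X when the signs make
   the product of the edge negative. *)
Definition gap_form X e : R :=
  \sum_(v in e) X v ^+ k - k%:R * \prod_(v in e) X v.

(** The AM-GM inequality for the numbers [X v ^+ k], with its equality case. *)
Lemma gap_form_ge0 X e : #|e| = k -> {in e, forall v, 0 <= X v} ->
  0 <= gap_form X e ?= iff [forall v in e, forall w in e, X v == X w].
Proof.
move=> ce X0.
have E0 : {in e, forall v, 0 <= X v ^+ k} by move=> v /X0 h; exact: exprn_ge0.
have := @leif_AGM R V (mem e) (fun v => X v ^+ k) E0.
have -> : [forall v in e, forall w in e, X v ^+ k == X w ^+ k]
        = [forall v in e, forall w in e, X v == X w].
  apply: eq_forallb_in => v ve; apply: eq_forallb_in => w we.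
  by rewrite eqrXn2 // X0.
rewrite [#|mem e|]ce prodrXl.
set P := \prod_(v in e) X v; set S := \sum_(v in e) X v ^+ k.
have P0 : 0 <= P by apply: prodr_ge0 => v; exact: X0.
have S0 : 0 <= S by apply: sumr_ge0 => v; exact: E0.
have Sk : 0 <= S / k%:R by apply: divr_ge0 => //; exact: ltW.
case; rewrite ler_pXn2r ?nnegrE // eqrXn2 // => le eq.
rewrite /gap_form -/P -/S; split; first by rewrite subr_ge0 mulrC -ler_pdivlMr.
rewrite -eq; apply/eqP/eqP => [h|->].
  have -> : S = P * k%:R by lra.
  by rewrite mulfK // gt_eqF.
by rewrite mulrC divfK ?subrr // gt_eqF.
Qed.

(** Supermodularity of the product on nonnegative vectors, for [X] and the constant vector [s]. *)
Lemma prod_max_min X e s : 0 <= s -> {in e, forall v, 0 <= X v} ->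
  \prod_(v in e) X v + s ^+ #|e| <=
  \prod_(v in e) Num.max (X v) s + \prod_(v in e) Num.min (X v) s.
Proof.
move=> s0 X0; rewrite -prodr_const -![\prod_(_ in e) _]big_enum /=.
have {X0} : {in enum e, forall v, 0 <= X v} by move=> v; rewrite mem_enum => /X0.
(* The inequality alone does not pass through the induction; the order relations between the four
   partial products must be carried along. *)
pose K (a b c d : R) :=
  [/\ 0 <= d, d <= a, d <= b & [/\ a <= c, b <= c & a + b <= c + d]].
move=> X0; suff [_ _ _ []] : K (\prod_(v <- enum e) X v) (\prod_(v <- enum e) s)
  (\prod_(v <- enum e) Num.max (X v) s) (\prod_(v <- enum e) Num.min (X v) s) by [].
elim: (enum e) X0 => [|v q IH] X0; first by rewrite !big_nil.
rewrite !big_cons; have x0 : 0 <= X v by apply: X0; rewrite mem_head.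
have {IH} : K _ _ _ _ := IH (fun w wq => X0 w (mem_behead (s := v :: q) wq)).
move: (X v) (\prod_(v <- q) X v) (\prod_(v <- q) s) (\prod_(v <- q) Num.max (X v) s)
  (\prod_(v <- q) Num.min (X v) s) x0 => x a b c d x0 [d0 da db [ac bc le]].
have a0 := le_trans d0 da; have b0 := le_trans d0 db.
rewrite /K maxEle minEle; case: (leP x s) => xs.
  split; [exact: mulr_ge0 | exact: ler_pM | exact: ler_pM | split].
  - exact: ler_pM.
  - exact: ler_wpM2l.
  - nra.
have xs' := ltW xs.
split; [exact: mulr_ge0 | exact: ler_pM | exact: ler_wpM2l | split].
- exact: ler_wpM2l.
- exact: ler_pM.
- nra.
Qed.

(* Since max^k + min^k = X^k + s^k entrywise, this reduces to the AM-GM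
   inequality for the entries min(X v, s). *)
Lemma gap_form_max X e s : #|e| = k -> 0 <= s -> {in e, forall v, 0 <= X v} ->
  gap_form (fun v => Num.max (X v) s) e <= gap_form X e /\
  (gap_form X e <= gap_form (fun v => Num.max (X v) s) e ->
   {in e &, forall v w, Num.min (X v) s = Num.min (X w) s}).
Proof.
move=> ce s0 X0.
have m0 : {in e, forall v, 0 <= Num.min (X v) s}.
  by move=> v ve; rewrite le_min s0 X0.
have [ge eq] := gap_form_ge0 ce m0.
have pm := prod_max_min s0 X0.
have sm : \sum_(v in e) Num.max (X v) s ^+ k + \sum_(v in e) Num.min (X v) s ^+ k
        = \sum_(v in e) X v ^+ k + k%:R * s ^+ k.
  rewrite -big_split /= -[X in k%:R * X]/(s ^+ k) mulr_natl.
  rewrite -[X in _ *+ X]ce -sumr_const -big_split /=; apply: eq_bigr => v _.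
  by rewrite maxEle minEle; case: (leP (X v) s) => _ //; rewrite addrC.
rewrite ce in pm.
move: ge eq; rewrite /gap_form => ge eq.
have pm' : 0 <= k%:R * (\prod_(v in e) Num.max (X v) s +
    \prod_(v in e) Num.min (X v) s - (\prod_(v in e) X v + s ^+ k)).
  by apply: mulr_ge0; [exact: ltW | rewrite subr_ge0].
rewrite mulrBr !mulrDr in pm'.
(* By [sm] and [pm'], the gaps of the maximum and of the minimum together are at most the gap of
   [X], since the constant vector has gap 0. The gap of the minimum is nonnegative. *)
split; first by lra.
move=> le v w ve we.
have : 0 == \sum_(v in e) Num.min (X v) s ^+ k - k%:R * \prod_(v in e) Num.min (X v) s.
  by apply/eqP; lra.
by rewrite eq => /forall_inP/(_ v ve)/forall_inP/(_ w we)/eqP.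
Qed.

End Edge.

(** * Truncation at rising levels along the attached edges *)

Section Levels.
Variables (V : finType) (X : V -> R) (l : R).
Hypothesis X0 : forall v, 0 <= X v.
Implicit Types (A B C P : {set V}) (sg : R) (s : seq (V * {set V})) (q : V * {set V}).

Definition top_level (sg : R) C : R := \big[Num.max/sg]_(v in C) X v.

Lemma top_level_ge sg C : sg <= top_level sg C.
Proof. exact: bigmax_ge_id. Qed.

Lemma le_top_level sg C c : c \in C -> X c <= top_level sg C.
Proof. exact: le_bigmax_cond. Qed.

Lemma top_level_le sg C t :
  sg <= t -> {in C, forall c, X c <= t} -> top_level sg C <= t.
Proof. by move=> h1 h2; apply: bigmax_le => // c /h2. Qed.

Lemma top_level_attained sg C : (0 < #|C|)%N ->
  exists2 c, c \in C & top_level sg C = Num.max (X c) sg.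
Proof.
case/card_gt0P=> c0 c0C; case: (arg_maxP X c0C) => c cC cmax; exists c => //.
apply/le_anti/andP; split.
  by apply: top_level_le => [|d dC]; rewrite le_max ?lexx ?orbT //; apply/orP; left; exact: cmax.
by rewrite ge_max top_level_ge le_top_level.
Qed.

(** The share of one attached edge in the form minus [l] times the norm. Only new vertices enter the
    norm, as [q.1] was counted earlier. *)
Definition step_gap (Y : V -> R) q : R :=
  gap_form Y (step_edge q) - l * \sum_(v in q.2) Y v ^+ k.

(* The i-th edge is truncated from below at the level sg_i, where sg_(i+1) is
   the largest of sg_i and the entries on the new vertices of the i-th edge. *)
Fixpoint level_gap (sg : R) s : R :=
  if s is q :: s' then
    step_gap (fun v => Num.max (X v) sg) q + level_gap (top_level sg q.2) s'
  else 0.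

(** What equality in [level_gap_le] forces for [0 < l] when no starting entry exceeds the level. *)
Fixpoint tight (sg : R) s : Prop :=
  if s is q :: s' then
    [/\ X q.1 = sg, {in q.2, forall c, sg <= X c} & tight (top_level sg q.2) s']
  else True.

Lemma step_gap_max q sg : 0 <= l -> 0 <= sg -> #|step_edge q| = k ->
  step_gap (fun v => Num.max (X v) sg) q <= step_gap X q.
Proof.
move=> l0 sg0 ce; have [le _] := gap_form_max ce sg0 (fun v _ => X0 v).
apply: lerB => //; apply: ler_wpM2l => //; apply: ler_sum => v _.
by rewrite ler_pXn2r ?nnegrE ?le_max ?lexx ?X0.
Qed.

(** Equality in the norm term, where [0 < l] enters, keeps the new entries at or above [sg]. Their
    minimum with [sg] is then [sg], and the equality case of AM-GM transfers this to [q.1]. *)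
Lemma step_gap_tight q sg : 0 < l -> 0 <= sg -> #|step_edge q| = k ->
  (0 < #|q.2|)%N -> X q.1 <= sg ->
  step_gap X q <= step_gap (fun v => Num.max (X v) sg) q ->
  X q.1 = sg /\ {in q.2, forall c, sg <= X c}.
Proof.
move=> l0 sg0 ce /card_gt0P[c0 c0C] pl; rewrite /step_gap => le.
have [gle geq] := gap_form_max ce sg0 (fun v _ => X0 v).
have d0 v : v \in q.2 -> 0 <= Num.max (X v) sg ^+ k - X v ^+ k.
  by rewrite subr_ge0 ler_pXn2r ?nnegrE ?le_max ?lexx ?X0.
have sle : \sum_(v in q.2) X v ^+ k <= \sum_(v in q.2) Num.max (X v) sg ^+ k.
  by rewrite -subr_ge0 -sumrB; apply: sumr_ge0.
have sl := ler_wpM2l (ltW l0) sle.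
have {}geq := geq ltac:(lra).
have seq0 : \sum_(v in q.2) (Num.max (X v) sg ^+ k - X v ^+ k) = 0.
  rewrite sumrB; apply: (mulfI (lt0r_neq0 l0)); lra.
have Cge : {in q.2, forall c, sg <= X c}.
  move=> c cC; have /allP/(_ c (mem_index_enum c)) : all (fun v => (v \in q.2) ==>
      (Num.max (X v) sg ^+ k - X v ^+ k == 0)) (index_enum V).
    by rewrite -psumr_eq0 // seq0.
  rewrite cC subr_eq0 eqrXn2 ?le_max ?X0 //= => /eqP <-.
  by rewrite le_max lexx orbT.
split=> //; apply/le_anti; rewrite pl /=.
have pe : q.1 \in step_edge q by rewrite !inE eqxx.
have ce0 : c0 \in step_edge q by rewrite inE c0C orbT.
have := geq _ _ pe ce0; rewrite (min_idPr (Cge _ c0C)) => <-.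
by rewrite ge_min lexx.
Qed.

Lemma step_card q A : q.1 \in A -> [disjoint A & q.2] -> #|q.2| == k.-1 ->
  #|step_edge q| = k /\ (0 < #|q.2|)%N.
Proof.
move=> qA dA /eqP cC; rewrite cardsU1 cC (disjointFr dA qA) add1n prednK //.
by split=> //; case: (k) k1 => [|[]].
Qed.

Lemma level_gap_le A B s sg : growth k A s B -> 0 <= l -> 0 <= sg ->
  level_gap sg s <= \sum_(q <- s) step_gap X q.
Proof.
elim: s A sg => [|q s IH] A sg /= g l0 sg0; first by rewrite big_nil.
case/and4P: g => qA dA cC g; have [ce _] := step_card qA dA cC.
rewrite big_cons; apply: lerD; first exact: step_gap_max.
by apply: IH g _ _ => //; apply: le_trans sg0 (top_level_ge _ _).
Qed.

Lemma level_gap_tight A B s sg : growth k A s B -> 0 < l -> 0 <= sg ->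
  {in A, forall v, X v <= sg} ->
  \sum_(q <- s) step_gap X q <= level_gap sg s -> tight sg s.
Proof.
elim: s A sg => [//|q s IH] A sg /= g l0 sg0 Xsg.
case/and4P: g => qA dA cC g; have [ce cC0] := step_card qA dA cC.
rewrite big_cons => le.
have le1 := step_gap_max (ltW l0) sg0 ce.
have tl0 : 0 <= top_level sg q.2 := le_trans sg0 (top_level_ge _ _).
have le2 := level_gap_le g (ltW l0) tl0.
have [] := step_gap_tight l0 sg0 ce cC0 (Xsg _ qA); first by lra.
move=> h1 h2; split=> //; apply: IH g _ _ _ _ => //; last by lra.
move=> v; rewrite inE => /orP[/Xsg h|]; last exact: le_top_level.
exact: le_trans h (top_level_ge _ _).
Qed.

Lemma tight_edge_ge sg s e : tight sg s -> e \in map (@step_edge V) s ->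
  {in e, forall v, sg <= X v}.
Proof.
elim: s sg => [//|q s IH] sg /= [h1 h2 /IH h3]; rewrite inE => /orP[/eqP->|es] v.
  by rewrite !inE => /orP[/eqP->|/h2 //]; rewrite h1.
by move=> /(h3 es); apply: le_trans; exact: top_level_ge.
Qed.

Lemma tight_new_ge A B s sg c : tight sg s -> growth k A s B ->
  c \in B -> c \notin A -> sg <= X c.
Proof.
move=> t g cB cA; suff [e es ce] : exists2 e, e \in map (@step_edge V) s & c \in e.
  exact: tight_edge_ge t es c ce.
elim: s A g cA {t} => [|q s IH] A /=; first by move=> /eqP->; rewrite cB.
case/and4P=> _ _ _ g cA; have [cC|cC] := boolP (c \in q.2).
  by exists (step_edge q); rewrite ?mem_head // inE cC orbT.
have [|e es ce] := IH _ g; first by rewrite inE negb_or cA.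
by exists e => //; rewrite inE es orbT.
Qed.

(* If the level did not rise at a step, all edges at a new vertex c of that
   step would have product at least X c ^+ k. *)
Lemma tight_pathlike A B P s sg : growth k A s B -> 0 <= sg -> tight sg s ->
  {in A, forall v, X v <= sg} -> {in A, forall v, v \notin P -> X v < sg} ->
  (forall c, c \in B -> c \notin A -> exists e,
    [/\ e \in map (@step_edge V) s, c \in e & \prod_(v in e) X v < X c ^+ k]) ->
  pathlike P s.
Proof.
elim: s A P sg => [//|q s IH] A P sg g sg0 t.
have tge := tight_edge_ge t.
case: t => h1 h2 t3; have g' := g; case/and4P: g' => qA dA cC g'.
have [_ cC0] := step_card qA dA cC => XA XP H.
apply/andP; split.
  by apply/negPn/negP=> /(XP _ qA); rewrite h1 ltxx.
have lt : sg < top_level sg q.2.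
  rewrite ltNge; apply/negP=> le; case/card_gt0P: cC0 => c cinC.
  have cA : c \notin A by rewrite (disjointFl dA cinC).
  have cB : c \in B by apply: (subsetP (growth_sub g')); rewrite inE cinC orbT.
  have Xc : X c = sg.
    by apply/le_anti; rewrite h2 // andbT; apply: le_trans (le_top_level _ cinC) le.
  have [e [es _]] := H c cB cA.
  have -> : X c ^+ k = \prod_(v in e) sg.
    by rewrite prodr_const (growth_card k0 g es) Xc.
  rewrite ltNge => /negP; apply; apply: ler_prod => v ve.
  by rewrite sg0 (tge e es).
(* All of [A] now lies strictly below the new level, so the next edge can only hang in [q.2]. *)
apply: IH g' _ t3 _ _ _.
- exact: le_trans (ltW lt).
- move=> v; rewrite inE => /orP[/XA h|]; last exact: le_top_level.
  exact: le_trans h (ltW lt).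
- move=> v; rewrite inE => /orP[/XA h _|->//]; exact: le_lt_trans lt.
- move=> c cB; rewrite inE negb_or => /andP[cA cnC].
  have [e [es ce Pe]] := H c cB cA; exists e; split=> //.
  move: es; rewrite inE => /orP[/eqP E|//].
  by move: ce; rewrite E !inE (negPf cnC) orbF => /eqP E'; rewrite E' qA in cA.
Qed.

End Levels.
End Truncation.

(** * Comparison with the hyperpath *)

Section Comparison.
Variables (R : realType) (k : nat).
Hypotheses (k1 : (1 < k)%N) (kE : ~~ odd k).
Let k0 : (0 < k)%N := ltnW k1.
Let kR0 : 0 < k%:R :> R. Proof. by rewrite ltr0n. Qed.

Lemma norm_even_exp (a : R) : `|a| ^+ k = a ^+ k.
Proof. by rewrite -normrX ger0_norm // exprn_even_ge0. Qed.

(** The last term is a sign defect: it is nonnegative and vanishes exactly when the product of [x]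
    over [e] is not positive. *)
Lemma edge_form_gap (G : hypergraph) (x : G -> R) (e : {set G}) :
  edge_form k x e = gap_form k (fun v => `|x v|) e
    + k%:R * (\prod_(v in e) x v + \prod_(v in e) `|x v|).
Proof.
rewrite /edge_form /gap_form.
have -> : \sum_(v in e) `|x v| ^+ k = \sum_(v in e) x v ^+ k.
  by apply: eq_bigr => v _; rewrite norm_even_exp.
by rewrite mulrDr; ring.
Qed.

Lemma prod_add_norm_ge0 (V : finType) (x : V -> R) (e : {set V}) :
  0 <= \prod_(v in e) x v + \prod_(v in e) `|x v|.
Proof. by rewrite -normr_prod -lerBlDr sub0r lerNnormlW. Qed.

Lemma edge_form_ge_gap (G : hypergraph) (x : G -> R) (e : {set G}) :
  gap_form k (fun v => `|x v|) e <= edge_form k x e.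
Proof. by rewrite edge_form_gap lerDl mulr_ge0 ?prod_add_norm_ge0 // ltW. Qed.

(** At the first step with a positive new entry [X c], the edge product rises from 0 to at least
    [X c * eps ^+ k.-1], while the sum of powers rises by at most [k%:R * eps ^+ k]. Hence [a] is
    [X c]; the other steps do not increase. *)
Lemma level_gap_vanish (V : finType) (X : V -> R) l (A B : {set V}) s :
  (forall v, 0 <= X v) -> 0 <= l -> growth k A s B ->
  {in A, forall v, X v = 0} -> (exists2 v, v \in B & 0 < X v) ->
  exists2 a, 0 < a & forall eps, 0 < eps -> eps <= a ->
    level_gap k X l eps s <=
    \sum_(q <- s) step_gap k l X q + k%:R * eps ^+ k.-1 * (eps - a).
Proof.
move=> X0 l0; elim: s A => [|q s IH] A /=.
  by move/eqP <- => XA [v /XA ->]; rewrite ltxx.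
move=> /and4P[qA dA cC g] XA XB; have [ce cC0] := step_card k1 qA dA cC.
have [/existsP[c /andP[cinC Xc]]|noC] :=
  boolP [exists c, (c \in q.2) && (0 < X c)]; last first.
  have XC : {in q.2, forall v, X v = 0}.
    move=> v vC; apply/le_anti; rewrite X0 andbT leNgt.
    by apply: contra noC => h; apply/existsP; exists v; rewrite vC.
  have [|a a0 ha] := IH _ g _ XB.
    by move=> v; rewrite inE => /orP[/XA|/XC].
  exists a => // eps e0 ea; rewrite big_cons.
  have -> : top_level X eps q.2 = eps.
    apply/le_anti; rewrite top_level_ge andbT; apply: top_level_le => // v /XC ->.
    exact: ltW.
  rewrite -[leRHS]addrA; apply: lerD; last exact: ha.
  exact: (step_gap_max k1 X0 l0 (ltW e0) ce).
exists (X c) => // eps e0 ea; rewrite big_cons [leRHS]addrAC; apply: lerD; last first.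
  apply: (level_gap_le k1 X0 g l0).
  exact: le_trans (ltW e0) (top_level_ge _ _ _).
have m0 v : 0 <= Num.max (X v) eps by rewrite le_max X0.
have sle : \sum_(v in q.2) X v ^+ k <= \sum_(v in q.2) Num.max (X v) eps ^+ k.
  by apply: ler_sum => v _; rewrite ler_pXn2r ?nnegrE ?le_max ?lexx ?X0.
have sl := ler_wpM2l l0 sle.
have cne : c \in step_edge q by rewrite inE cinC orbT.
have P0 : \prod_(v in step_edge q) X v = 0.
  by rewrite (big_setD1 q.1) ?inE ?eqxx //= XA // mul0r.
have Sm : \sum_(v in step_edge q) Num.max (X v) eps ^+ k <=
    \sum_(v in step_edge q) X v ^+ k + k%:R * eps ^+ k.
  rewrite mulr_natl -[X in _ *+ X]ce -sumr_const -big_split /=.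
  apply: ler_sum => v _; rewrite maxEle; case: ifP => _.
    by rewrite lerDr exprn_ge0.
  by rewrite lerDl exprn_ge0 // ltW.
have Pm : X c * eps ^+ k.-1 <= \prod_(v in step_edge q) Num.max (X v) eps.
  rewrite (big_setD1 c cne) /= (max_idPl ea); apply: ler_wpM2l => //.
  have <- : #|step_edge q :\ c| = k.-1 by have := cardsD1 c (step_edge q); rewrite cne ce => ->.
  rewrite -prodr_const; apply: ler_prod => v _.
  by rewrite (ltW e0) le_max lexx orbT.
have kPm := ler_wpM2l (ltW kR0) Pm.
have ek : eps ^+ k = eps * eps ^+ k.-1 by rewrite -exprS prednK.
rewrite /step_gap /gap_form P0 mulr0 subr0; rewrite ek in Sm.
by rewrite mulrBr; nra.
Qed.

(** Each edge of the path in [W] receives the truncated values of the corresponding edge of [V], the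
    largest at the vertex where the next edge hangs. The absolute value there is thus the next
    level. *)
Lemma level_gap_realized (V W : hypergraph) (X : V -> R) l (A B : {set V})
    (A' B' P' : {set W}) s t d' (y : W -> R) sg :
  growth k A s B -> growth k A' t B' -> size s = size t -> pathlike P' t ->
  {in A, forall v, X v <= sg} -> `|y (head d' (unzip1 t))| = sg ->
  exists y' : W -> R, {in A', y' =1 y} /\
    \sum_(q <- t) (edge_form k y' (step_edge q) - l * \sum_(v in q.2) y' v ^+ k)
      = level_gap k X l sg s.
Proof.
elim: s t A A' P' d' y sg => [|q s IH] [|q' t] //= A A' P' d' y sg.
  by move=> _ _ _ _ _ _; exists y; split=> //; rewrite big_nil.
case/and4P=> qA dA cC g /and4P[q'A dA' cC' g'] [sz] /andP[_ pt] XA yq.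
have [_ cC0] := step_card k1 qA dA cC; have [_ cC0'] := step_card k1 q'A dA' cC'.
have [cs csC Ecs] := top_level_attained X sg cC0.
case/card_gt0P: (cC0') => c' cinC'.
set rho := head c' (unzip1 t); have rhoC : rho \in q'.2 := pathlike_head cinC' pt.
have [psi [psii psiC psirho]] := exists_bij_pointed
  (etrans (eqP cC') (esym (eqP cC))) rhoC csC.
pose M v := Num.max (X v) sg.
(* This sign makes the edge product minus the product of the truncated entries, so the edge form
   equals the gap form. *)
pose b : R := if 0 <= y q'.1 then -1 else 1.
pose sgn w : R := if w == rho then b else 1.
have nb : `|b| = 1 by rewrite /b; case: ifP; rewrite ?normrN normr1.
have yb : y q'.1 * b = - sg.
  rewrite -yq /b; case: ifP => h; first by rewrite mulrN1 ger0_norm.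
  by rewrite mulr1 ltr0_norm ?opprK // ltNge h.
have sg0 : 0 <= sg by rewrite -yq.
have M0 v : 0 <= M v by rewrite le_max sg0 orbT.
pose y1 w := if w \in q'.2 then sgn w * M (psi w) else y w.
have y1A : {in A', y1 =1 y} by move=> w wA; rewrite /y1 (disjointFr dA' wA).
have y1rho : `|y1 (head c' (unzip1 t))| = top_level X sg q.2.
  by rewrite -/rho /y1 rhoC /sgn eqxx psirho normrM nb mul1r Ecs ger0_norm ?M0.
have [|y' [y'1 y'2]] := IH t _ _ q'.2 c' y1 _ g g' sz pt _ y1rho.
  move=> v; rewrite inE => /orP[/XA h|]; last exact: le_top_level.
  exact: le_trans h (top_level_ge _ _ _).
have y'A : {in A', y' =1 y} by move=> w wA; rewrite y'1 ?y1A // inE wA.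
have y'C : {in q'.2, forall w, y' w = sgn w * M (psi w)}.
  by move=> w wC; rewrite y'1 ?inE ?wC ?orbT // /y1 wC.
exists y'; split=> //; rewrite big_cons y'2; congr (_ + _).
have sC : \sum_(w in q'.2) y' w ^+ k = \sum_(v in q.2) M v ^+ k.
  rewrite -psiC big_imset //=; apply: eq_bigr => w wC.
  rewrite y'C // exprMn -[sgn w ^+ k]norm_even_exp /sgn.
  by case: eqP => _; rewrite ?nb ?normr1 expr1n mul1r.
have pC : \prod_(w in q'.2) y' w = b * \prod_(v in q.2) M v.
  rewrite -psiC big_imset //= (eq_bigr _ y'C) big_split /=; congr (_ * _).
  rewrite (bigD1 rho) //= /sgn eqxx big1 ?mulr1 // => w /andP[_ /negPf ->].
  by [].
have nq : q.1 \notin q.2 by rewrite (disjointFr dA qA).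
have nq' : q'.1 \notin q'.2 by rewrite (disjointFr dA' q'A).
have Mq : M q.1 = sg by apply/max_idPr; exact: XA.
rewrite /step_gap /edge_form /gap_form /step_edge sC; rewrite /M in sC pC Mq *; congr (_ - _).
have yk : y q'.1 ^+ k = sg ^+ k by rewrite -yq norm_even_exp.
rewrite !big_setU1 //= sC pC y'A // [y q'.1 * _]mulrA yb Mq yk.
by rewrite mulNr mulrN.
Qed.

Lemma grown_slap_form (G0 G : hypergraph) (f : G0 -> G) s (x : G -> R) :
  grown k f s -> slap_form k x =
    slap_form k (x \o f) + \sum_(q <- s) edge_form k x (step_edge q).
Proof.
move=> [fi g E]; rewrite /slap_form E (growth_big_edge _ _ k1 g) /=; last first.
  by move=> _ /imsetP[e _ ->]; apply: imsetS; exact: finset.subsetT.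
congr (_ + _); rewrite big_imset /=; last by move=> ? ? _ _; exact: imset_inj.
apply: eq_bigr => e _; rewrite /edge_form !big_imset //= => ? ? _ _; exact: fi.
Qed.

Lemma grown_knorm (G0 G : hypergraph) (f : G0 -> G) s (x : G -> R) :
  grown k f s -> knorm k x =
    knorm k (x \o f) + \sum_(q <- s) \sum_(v in q.2) x v ^+ k.
Proof.
move=> [fi g _]; rewrite /knorm.
have setTE (T : finType) (F : T -> R) : \sum_v F v = \sum_(v in [set: T]) F v.
  by apply: eq_bigl => v; rewrite inE.
rewrite setTE (growth_big_vertex _ _ g) /= [in RHS]setTE; congr (_ + _).
by rewrite big_imset //= => ? ? _ _; exact: fi.
Qed.

Lemma grown_uniform (G0 G : hypergraph) (f : G0 -> G) s :
  k_uniform k G0 -> grown k f s -> k_uniform k G.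
Proof.
move=> u0 [fi g E] e; rewrite E !inE => /orP[/imsetP[e0 h ->]|].
  by rewrite card_imset // u0.
exact: growth_card g.
Qed.

Lemma prod_lt0_odd (V : finType) (x : V -> R) (e : {set V}) :
  \prod_(v in e) x v < 0 -> odd #|e :&: [set v | x v < 0]|.
Proof.
under eq_bigr do rewrite [x _]numEsign.
rewrite big_split /= -expr_sum.
have -> : (\sum_(v in e) (x v < 0)%R)%N = #|e :&: [set v | x v < 0]|.
  rewrite -sum1_card big_mkcond [RHS]big_mkcond /=; apply: eq_bigr => v _.
  by rewrite !inE; case: (v \in e); case: (x v < 0).
rewrite -signr_odd; case: odd => //; rewrite expr0 mul1r ltNge => /negP[].
by apply: prodr_ge0 => v _.
Qed.

(* At a nonpositive eigenvalue equality holds in AM-GM on every edge: |x| is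
   constant and nonzero, and the negative vertices give an odd bipartition. *)
Lemma eigenvalue_gt0 (G0 G : hypergraph) (f : G0 -> G) s (x : G -> R) l :
  k_uniform k G0 -> hconnected G0 -> ~ odd_bipartite G0 -> grown k f s ->
  (exists v, x v != 0) -> slap_form k x = l * knorm k x -> 0 < l.
Proof.
move=> u0 co nob gr [v0 xv0] Ex; rewrite ltNge; apply/negP=> l0.
have uG := grown_uniform u0 gr.
pose X v := `|x v|.
have ge0 e : e \in edges G -> 0 <= gap_form k X e ?=
    iff [forall v in e, forall w in e, X v == X w].
  by move=> eE; apply: gap_form_ge0 (uG e eE) _ => // v _; exact: normr_ge0.
have ef0 e : e \in edges G -> edge_form k x e = 0.
  have ef_ge0 e' : e' \in edges G -> 0 <= edge_form k x e'.
    by move=> e'E; apply: le_trans (edge_form_ge_gap _ _); exact: (ge0 e' e'E).1.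
  have s0 : slap_form k x = 0.
    apply/le_anti/andP; split; last exact: sumr_ge0.
    by rewrite Ex mulr_le0_ge0 ?knorm_ge0.
  move=> eE; have /allP/(_ e (mem_index_enum e)) : all (fun e => (e \in edges G) ==>
      (edge_form k x e == 0)) (index_enum {set G}).
    by rewrite -psumr_eq0 // -/(slap_form k x) s0.
  by rewrite eE => /eqP.
have gf0 e : e \in edges G -> gap_form k X e = 0.
  move=> eE; apply/le_anti; rewrite (ge0 e eE).1 andbT -(ef0 e eE).
  exact: edge_form_ge_gap.
have Xe e : e \in edges G -> {in e &, forall v w, X v = X w}.
  move=> eE v w ve we; have := (ge0 e eE).2; rewrite gf0 // eqxx => /esym.
  by move=> /forall_inP/(_ v ve)/forall_inP/(_ w we)/eqP.
have px e : e \in edges G -> \prod_(v in e) x v = - \prod_(v in e) X v.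
  move=> eE; have := edge_form_gap x e; rewrite ef0 // gf0 // add0r => /esym/eqP.
  by rewrite mulf_eq0 gt_eqF //= addr_eq0 => /eqP.
have [fi g E] := gr.
have feE e : e \in edges G0 -> f @: e \in edges G.
  by move=> eE; rewrite E inE imset_f.
have X0c u v : X (f u) = X (f v).
  have [q [wq <-]] := co u v; elim: q u wq => [//|[e w] q IH] u /=.
  move=> /and4P[eE ue we /IH]; rewrite /walk_end /= => <-.
  by apply: (Xe _ (feE e eE)); rewrite imset_f.
apply: nob; exists [set v | x (f v) < 0] => e eE.
apply: (@prod_lt0_odd _ (x \o f)).
have -> : \prod_(v in e) (x \o f) v = \prod_(v in f @: e) x v.
  by rewrite big_imset //= => ? ? _ _; exact: fi.
rewrite px ?feE // oppr_lt0 lt_neqAle prodr_ge0 ?andbT; last by move=> *; exact: normr_ge0.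
rewrite eq_sym; apply/prodf_neq0 => _ /imsetP[u _ ->].
apply/negP=> /eqP Xu0; move/eqP: xv0; apply; apply/eqP; rewrite -normr_eq0; apply/eqP.
(* A zero on the copy of [G0] spreads over that copy by constancy and then along the growth to all
   of [G], against [x v0 != 0]. *)
suff H (A B : {set G}) s' : growth k A s' B ->
    {subset map (@step_edge G) s' <= edges G} ->
    {in A, forall v, X v = 0} -> {in B, forall v, X v = 0}.
  apply: (H _ _ _ g); rewrite ?inE //.
    by move=> z zs; rewrite E !inE zs orbT.
  by move=> _ /imsetP[w _ ->]; rewrite (X0c w u).
elim: s' A => [|q s' IH] A /=; first by move/eqP->.
case/and4P=> qA _ _ g' sE XA; apply: (IH _ g').
  by move=> z zs; apply: sE; rewrite inE zs orbT.
move=> v; rewrite inE => /orP[/XA //|vC].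
rewrite (Xe (step_edge q) _ v q.1) ?XA //; last by rewrite !inE eqxx.
  by apply: sE; rewrite mem_head.
by rewrite inE vC orbT.
Qed.

End Comparison.

(** * Rigidity of a minimizing hypergraph *)

Section Extremal.
Variables (R : realType) (k m : nat) (G0 : hypergraph) (l : R).
Hypotheses (k1 : (1 < k)%N) (kE : ~~ odd k) (u0 : k_uniform k G0).
Hypothesis l_min : lbound (fun mu : R => exists G' : hypergraph,
  attach_class k m G0 G' /\ is_lambda_min k G' mu) l.
Let k0 : (0 < k)%N := ltnW k1.

(** The test vector is [z] on [G0], continued by truncated values of [X] along a hyperpath at [u].
    That hypergraph lies in the class, so its least eigenvalue is at least [l]. *)
Lemma hyperpath_level_gap (G : hypergraph) (f : G0 -> G) s (X : G -> R)
    (z : G0 -> R) u :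
  grown k f s -> size s = m -> (forall v, X (f v) <= `|z u|) ->
  0 <= slap_form k z - l * knorm k z + level_gap k X l `|z u| s.
Proof.
move=> [fi g E] sm Xz.
have [H [h [t [acH grt tm pt]]]] : exists (H : hypergraph) (h : G0 -> H) t,
    [/\ attach_class k m G0 H, grown k h t, size t = m & pathlike [set h u] t].
  have [t [grt tm pt]] := hyperpath_grown m u k1.
  eexists _, _, t; split; [exact: attach_class_hyperpath | exact: grt | by [] |].
  exact: pt.
have [hi gt Et] := grt.
pose y (w : H) : R := if [pick v | h v == w] is Some v then z v else 0.
have yh v : y (h v) = z v.
  by rewrite /y; case: pickP => [v' /eqP/hi -> //|/(_ v)]; rewrite eqxx.
have yhd : `|y (head (h u) (unzip1 t))| = `|z u|.
  have := pathlike_head (set11 (h u)) pt.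
  by rewrite in_set1 => /eqP ->; rewrite yh.
have [||y' [y'1 y'2]] := @level_gap_realized R k k1 kE G H X l _ _ _ _ _ s t _ y _
  g gt _ pt _ yhd.
- by rewrite sm.
- by move=> _ /imsetP[v _ ->]; exact: Xz.
have y'h : y' \o h = z.
  by apply: funext => v /=; rewrite y'1 ?imset_f.
have uH : k_uniform k H := grown_uniform k1 u0 grt.
have [mu [mu_min mu_ray]] := lambda_min_rayleigh R k1 kE uH (h u).
have lmu : l <= mu.
  by apply: l_min; exists H.
have := le_trans (ler_wpM2r (knorm_ge0 kE y') lmu) (mu_ray y').
rewrite (grown_slap_form k1 _ grt) (grown_knorm _ grt) y'h -y'2 sumrB -mulr_sumr.
lra.
Qed.

Section Minimizer.
Variables (G : hypergraph) (f : G0 -> G) (s : seq (G * {set G})) (x : {ffun G -> R}).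
Hypotheses (gr : grown k f s) (sm : size s = m) (l0 : 0 < l).
Hypothesis ev : forall v,
  tensor_apply (@signless_laplacian R k G) x v = l * x v ^+ k.-1.
Let X v := `|x v|.
Let X0 v : 0 <= X v. Proof. exact: normr_ge0. Qed.
Let uG : k_uniform k G := grown_uniform k1 u0 gr.

(** The identity between form and norm at the eigenvector, split into the part on [G0], the gaps of
    the attached edges and their sign defects. *)
Lemma eigenvector_balance :
  slap_form k (x \o f) - l * knorm k (x \o f) + \sum_(q <- s) step_gap k l X q
  + k%:R * \sum_(q <- s)
      (\prod_(v in step_edge q) x v + \prod_(v in step_edge q) X v) = 0.
Proof.
have := H_eigenpair_form k1 uG ev.
rewrite (grown_slap_form k1 _ gr) (grown_knorm _ gr) => /eqP.
rewrite -subr_eq0 => /eqP E; rewrite -[RHS]E.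
have -> : \sum_(q <- s) edge_form k x (step_edge q) =
    \sum_(q <- s) step_gap k l X q + l * \sum_(q <- s) \sum_(v in q.2) x v ^+ k
    + k%:R * \sum_(q <- s)
      (\prod_(v in step_edge q) x v + \prod_(v in step_edge q) X v).
  rewrite !mulr_sumr -!big_split /=; apply: eq_bigr => q _.
  rewrite (edge_form_gap kE) /step_gap; congr (_ + _).
  rewrite -/X; have -> : \sum_(v in q.2) X v ^+ k = \sum_(v in q.2) x v ^+ k.
    by apply: eq_bigr => v _; rewrite (norm_even_exp kE).
  by rewrite subrK.
by ring.
Qed.

Let P0 q : 0 <= \prod_(v in step_edge q) x v + \prod_(v in step_edge q) X v.
Proof. exact: prod_add_norm_ge0. Qed.

Lemma minimizer_nonzero_on_base : (0 < m)%N -> (exists v, x v != 0) ->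
  exists v, x (f v) != 0.
Proof.
move=> m0 [v0 xv0]; apply: contrapT => noz.
have xf v : x (f v) = 0.
  by apply/eqP/negPn/negP=> h; apply: noz; exists v.
have [fi g E] := gr.
have [u _] : exists u : G0, True.
  case: s sm g => [e|q s' _ /= /and4P[/imsetP[u _ _] _ _ _]]; last by exists u.
  by rewrite -e in m0.
have [a a0 ha] : exists2 a, 0 < a & forall eps, 0 < eps -> eps <= a ->
    level_gap k X l eps s <=
    \sum_(q <- s) step_gap k l X q + k%:R * eps ^+ k.-1 * (eps - a).
  apply: (level_gap_vanish k1 X0 (ltW l0) g).
    by move=> _ /imsetP[v _ ->]; rewrite /X xf normr0.
  by exists v0; rewrite ?inE // normr_gt0.
have B0 : \sum_(q <- s) step_gap k l X q <= 0.
  have := eigenvector_balance.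
  have -> : slap_form k (x \o f) = 0.
    rewrite /slap_form big1 // => e eE; rewrite /edge_form big1 ?add0r; last first.
      by move=> v _; rewrite /= xf expr0n; case: (k) k0.
    have /card_gt0P[v ve] : (0 < #|e|)%N by rewrite u0.
    by rewrite (big_setD1 v ve) /= xf mul0r mulr0.
  have -> : knorm k (x \o f) = 0.
    by rewrite /knorm big1 // => v _; rewrite /= xf expr0n; case: (k) k0.
  have : 0 <= k%:R * \sum_(q <- s)
      (\prod_(v in step_edge q) x v + \prod_(v in step_edge q) X v).
    by apply: mulr_ge0 => //; apply: sumr_ge0.
  lra.
pose N : R := #|edges G0|%:R.
have N0 : 0 <= N by exact: ler0n.
(* Each edge of [G0] costs [2 * k%:R * eps ^+ k]. With this choice [a - eps] is [(2 * N + 1) * eps],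
   so the gain covers all these costs and leaves [k%:R * eps ^+ k] over. *)
pose eps := a / (N * 2 + 2).
have d0 : 0 < N * 2 + 2 by lra.
have e0 : 0 < eps by exact: divr_gt0.
have ae : a = eps * (N * 2 + 2) by rewrite /eps divfK // gt_eqF.
have ea : eps <= a by rewrite ae; nra.
have h : 0 <= slap_form k (fun _ : G0 => eps) - l * knorm k (fun _ : G0 => eps)
    + level_gap k X l eps s.
  have := @hyperpath_level_gap G f s X (fun=> eps) u gr sm.
  rewrite gtr0_norm // => H; apply: H => v.
  by rewrite /X xf normr0 ltW.
have ek : eps ^+ k = eps * eps ^+ k.-1 by rewrite -exprS prednK.
have Q : slap_form k (fun _ : G0 => eps) = N * (2 * (k%:R * eps ^+ k)).
  transitivity (\sum_(e in edges G0) 2 * (k%:R * eps ^+ k)).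
    apply: eq_bigr => e eE; rewrite /edge_form sumr_const prodr_const u0 //.
    by rewrite -mulr_natl; ring.
  by rewrite sumr_const [RHS]mulr_natl.
have Kp : 0 < k%:R * eps ^+ k.-1 by rewrite mulr_gt0 ?ltr0n ?exprn_gt0.
have lN : 0 <= l * knorm k (fun _ : G0 => eps).
  by rewrite mulr_ge0 ?knorm_ge0 // ltW.
have := ha eps e0 ea; rewrite Q ek in h.
have -> : k%:R * eps ^+ k.-1 * (eps - a) =
    - (N * (2 * (k%:R * (eps * eps ^+ k.-1)))) - k%:R * eps ^+ k.-1 * eps.
  by rewrite ae; ring.
by have := mulr_gt0 Kp e0; lra.
Qed.

Hypothesis base : exists v, x (f v) != 0.

(** The comparison uses [x] itself on [G0] and a vertex [u] where its absolute value is maximal.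
    With [eigenvector_balance] it leaves no slack: truncation loses nothing and all sign defects
    vanish. *)
Lemma minimizer_pathlike : pathlike (f @: setT) s.
Proof.
have [v0 xv0] := base; have [fi g E] := gr.
pose u := [arg max_(v > v0) X (f v)]%O.
have umax v : X (f v) <= X (f u).
  by rewrite /u; case: arg_maxP => // w _ /(_ v isT).
have sg0 : 0 < X (f u) by apply: lt_le_trans (umax v0); rewrite normr_gt0.
have gap := @hyperpath_level_gap G f s X (x \o f) u gr sm umax.
have bal := eigenvector_balance.
have XA : {in f @: setT, forall v, X v <= X (f u)}.
  by move=> _ /imsetP[v _ ->].
have kP : 0 <= k%:R * \sum_(q <- s)
    (\prod_(v in step_edge q) x v + \prod_(v in step_edge q) X v).
  by apply: mulr_ge0 => //; apply: sumr_ge0.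
have le := level_gap_le k1 X0 g (ltW l0) (ltW sg0).
have t : tight X (X (f u)) s.
  by apply: (level_gap_tight k1 X0 g l0 (ltW sg0) XA); rewrite /= in gap; lra.
have px e : e \in map (@step_edge G) s -> \prod_(v in e) x v = - \prod_(v in e) X v.
  have S0 : \sum_(q <- s)
      (\prod_(v in step_edge q) x v + \prod_(v in step_edge q) X v) = 0.
    have kn : (k%:R : R) != 0 by rewrite pnatr_eq0 -lt0n.
    by apply: (mulfI kn); rewrite /= in gap; lra.
  case/mapP=> q qs ->; apply/eqP; rewrite -addr_eq0.
  by move/eqP: S0; rewrite psumr_eq0 // => /allP/(_ q qs).
apply: (tight_pathlike k1 g (ltW sg0) t XA) => [v -> //|c _ cA].
have Xc : 0 < X c := lt_le_trans sg0 (tight_new_ge t g (in_setT c) cA).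
(* Otherwise every edge at [c], necessarily an attached one, has product of absolute values at least
   [X c ^+ k]. The eigenvalue equation at [c], multiplied by [x c], then gives
   [l * x c ^+ k <= 0]. *)
apply: contrapT => none.
have ge e : e \in edges G -> c \in e -> x c ^+ k + \prod_(v in e) x v <= 0.
  rewrite E inE => /orP[/imsetP[e0 _ ->] ce|].
    by case/negP: cA; apply: (subsetP (imsetS f (finset.subsetT e0))).
  rewrite inE => es ce; rewrite px // subr_le0 -(norm_even_exp kE) leNgt.
  by apply/negP=> lt; apply: none; exists e.
have : l * x c ^+ k <= 0.
  rewrite -[k in X in X <= _]prednK // exprS mulrCA -ev.
  rewrite signless_laplacian_apply // mulrDr mulrCA -exprS prednK // degree_mul.
  rewrite /link_sum mulr_sumr -big_split /=; apply: sumr_le0 => e /andP[eE ce].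
  by rewrite prod_link_mul // ge.
by rewrite leNgt -(norm_even_exp kE) mulr_gt0 // exprn_gt0.
Qed.

End Minimizer.
End Extremal.

Local Close Scope ring_scope.

Theorem theorem4p4 (R : realType) (k m : nat) (G0 G : hypergraph) (l : R)
    (hk : 1 < k) (hk_even : ~~ odd k) (hm : 0 < m)
    (hG0_uniform : k_uniform k G0) (hG0_connected : hconnected G0)
    (hG0 : ~ odd_bipartite G0)
    (hG : attach_class k m G0 G)
    (hl : is_lambda_min k G l)
    (hmin : is_least
      (fun mu : R => exists G' : hypergraph,
         attach_class k m G0 G' /\ is_lambda_min k G' mu) l) :
  exists (u : G0) (w : hyperpath k m),
    pendent_vertex k w /\ isomorphic G (coalescence u w).
Proof.
have [f [s [gr sm]]] := attach_class_grown hk hG.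
have [[x [xn0 ev]] _] := hl.
have uG := grown_uniform hk hG0_uniform gr.
have xn : exists v, (x v != 0)%R.
  apply: contrapT => noz; move/eqP: xn0; apply; apply/ffunP => v.
  by rewrite ffunE; apply/eqP/negPn/negP => h; apply: noz; exists v.
have l0 := eigenvalue_gt0 hk hk_even hG0_uniform hG0_connected hG0 gr xn
  (H_eigenpair_form hk uG ev).
have [_ l_min] := hmin.
have base := minimizer_nonzero_on_base hk hk_even hG0_uniform l_min gr sm l0 ev hm xn.
have := minimizer_pathlike hk hk_even hG0_uniform l_min gr sm l0 ev base.
case: s gr sm => [_ e|q s gr sm]; first by rewrite -e in hm.
(* Only the first edge hangs on the copy of [G0], so its attaching vertex is the required [u]. *)
move=> ps; have /andP[/imsetP[u _ qu] ps'] := ps.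
have {ps ps'} ps : pathlike [set f u] (q :: s) by rewrite /= qu in_set1 eqxx.
exists u, (inl ord0); split; first exact: hyperpath_pendent.
have [t [gr' tm pt]] := hyperpath_grown m u hk.
by apply: (grown_pathlike_iso hk gr gr' _ ps pt); rewrite sm tm.
Qed.
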